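(* Consider Case 4 of the problem described in the context (density $\rho$ unknown; $k,c,\ell>0$, $T_m$, $T_0>T_m$, $q_0>0$ given), whose solution for $0<\alpha<1$ and any data is $\rho_\alpha=\frac{q_0^2\Gamma^2(1-\frac{\alpha}{2})}{kc(T_0-T_m)^2}[1-W(-\xi_\alpha;-\frac{\alpha}{2},1)]^2$, $T_\alpha(x,t)=T_0-\frac{T_0-T_m}{1-W(-\xi_\alpha;-\frac{\alpha}{2},1)}[1-W(-\frac{x}{\lambda_\alpha t^{\alpha/2}};-\frac{\alpha}{2},1)]$, $s_\alpha(t)=\lambda_\alpha\xi_\alpha t^{\alpha/2}$, $\lambda_\alpha=\frac{k(T_0-T_m)}{q_0\Gamma(1-\frac{\alpha}{2})[1-W(-\xi_\alpha;-\frac{\alpha}{2},1)]}$, with $\xi_\alpha>0$ the unique solution of $\frac{x[1-W(-x;-\frac{\alpha}{2},1)]}{M_{\alpha/2}(x)}=\frac{c(T_0-T_m)\Gamma(1-\frac{\alpha}{2})}{\ell\Gamma(1+\frac{\alpha}{2})}$, $x>0$. Then, for any data, as $\alpha\to1^-$ this solution coincides with the following one (the classical case $\alpha=1$): $$s_1(t)=2\lambda_1\mu_1t^{1/2},\quad T_1(x,t)=T_0-\frac{T_0-T_m}{\operatorname{erf}(\mu_1)}\operatorname{erf}\left(\frac{x}{2\lambda_1t^{1/2}}\right),$$ $$\rho_1=\frac{\pi q_0^2}{kc(T_0-T_m)^2}\operatorname{erf}^2(\mu_1),\quad \lambda_1=\frac{k(T_0-T_m)}{q_0\sqrt{\pi}\,\operatorname{erf}(\mu_1)},$$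 where $\mu_1>0$ is the unique solution of $$x\exp(x^2)\operatorname{erf}(x)=\frac{c(T_0-T_m)}{\ell\sqrt{\pi}},\quad x>0.$$
   Context: For $0<\alpha<1$ the Caputo derivative is $D^\alpha f(t)=\frac{1}{\Gamma(1-\alpha)}\int_0^t \frac{f'(\tau)}{(t-\tau)^\alpha}d\tau$, and $D^1f=f'$. The Wright function is $W(z;a,b)=\sum_{n\ge0}\frac{z^n}{n!\,\Gamma(na+b)}$ ($a>-1$, $b\in\mathbb{R}$); the Mainardi function is $M_\nu(z)=W(-z;-\nu,1-\nu)$. $\operatorname{erf}(x)=\frac{2}{\sqrt\pi}\int_0^x e^{-u^2}du$. The problem (for $0<\alpha\le 1$): with positive constants $\rho,k,c,\ell$, $\lambda^2=k/(\rho c)$, melting temperature $T_m$, $T_0>T_m$, $q_0>0$, find $s(t)$, $T(x,t)$ and the unknown coefficient with $D^\alpha T=\lambda^2T_{xx}$ in $0<x<s(t)$, $t>0$; $s(0)=0$; $T(x,0)=T(+\infty,t)=T_m$; $T(s(t),t)=T_m$; $-kT_x(s(t),t)=\rho\ell D^\alpha s(t)$; $T(0,t)=T_0$; $kT_x(0,t)=-q_0/t^{\alpha/2}$ for $t>0$. *)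

(* Defs.v *)
From Stdlib Require Import Reals.
From Coquelicot Require Import Coquelicot.
Open Scope R_scope.

(* Euler Gamma function, Gamma(x) = int_0^oo t^(x-1) e^(-t) dt (meaningful for x > 0). *)
Definition Gamma (x : R) : R :=
  RInt_gen (fun t => Rpower t (x - 1) * exp (- t)) (at_right 0) (Rbar_locally p_infty).

Fixpoint poch (x : R) (n : nat) : R :=
  match n with
  | O => 1
  | S m => poch x m * (x + INR m)
  end.

(* Reciprocal Gamma function 1/Gamma, extended to all reals via
   1/Gamma(x) = x(x+1)...(x+N-1) / Gamma(x+N) with x+N > 0
   (so that 1/Gamma vanishes at the poles 0,-1,-2,...). *)
Definition rgamma (x : R) : R :=
  let N := (Z.to_nat (up (- x)) + 1)%nat in
  poch x N / Gamma (x + INR N).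

Definition Wright (z a b : R) : R :=
  Series (fun n => z ^ n / INR (Factorial.fact n) * rgamma (INR n * a + b)).

Definition Mainardi (nu z : R) : R := Wright (- z) (- nu) (1 - nu).

Definition erf (x : R) : R := 2 / sqrt PI * RInt (fun u => exp (- u ^ 2)) 0 x.

(* Main.v *)
Require Import Defs.
From Stdlib Require Import Reals ZArith Lra Lia.
From Coquelicot Require Import Coquelicot.
Open Scope R_scope.

(** As [a -> 1], the Wright and Mainardi functions converge, locally uniformly
in the argument, to the Wright functions of parameter [-1/2]: for [n a + b >= -n/2] the recurrence
[1/Gamma(z) = z/Gamma(z+1)] gives [|1/Gamma(n a + b)| <= 12 n! / (floor(n/2))!], so the series are
dominated uniformly in [a] and converge by Tannery's theorem.  At [a = 1] the Mainardi function
solves [y' = -z y / 2] and [Gamma(1/2) = sqrt PI], hence it is [exp(-z^2/4) / sqrt PI], and its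
primitive [1 - W(-z; -1/2, 1)] is [erf(z/2)].  The limit equation for the front changes sign at
[2 mu1]; for [a] near [1] so does the equation for [xi a], which by continuity and uniqueness
forces [xi a -> 2 mu1].  Everything else is continuity. *)

(** * The Gamma integral *)

(** The Wright parameter is [- a / 2], with [a] the order of the derivative. At negative arguments
    [rgamma] is controlled by integer shifts into [[2, 4]], where [Gamma >= 1/2]: this bounds its
    values and keeps the denominator nonzero for continuity. The order and the argument move
    together, because [xi a] and the similarity variable both depend on [a]. Limits of Wright
    functions are therefore stated along an arbitrary filter, which covers [a -> 1], joint limits,
    and continuity in [x] at fixed [a]. For a given [a < 1] nothing says that the Mainardi
    denominator is nonzero. Its positivity is read off from the positive limit, jointly in order and
    argument, near [(1, 2 mu1)], and the intermediate value theorem is confined to a window there.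
    Uniqueness of [xi a] ranges over all positive [x], so a root found in a small window must be
    [xi a]. *)

Lemma locally_within (x : R) (D : R -> Prop) : filter_le (within D (locally x)) (locally x).
Proof. intros P [d HP]. exists d. auto. Qed.

Lemma at_right_0_pos : at_right 0 (fun t => 0 < t).
Proof. exists (mkposreal 1 Rlt_0_1). now intros. Qed.

Lemma p_infty_pos : Rbar_locally p_infty (fun t => 0 < t).
Proof. exists 0. now intros. Qed.

Lemma filter_prod_pos (P : R -> Prop) :
  (forall t, 0 < t -> P t) ->
  filter_prod (at_right 0) (Rbar_locally p_infty) (fun ab : R * R =>
    forall x, Rmin (fst ab) (snd ab) <= x <= Rmax (fst ab) (snd ab) -> P x).
Proof.
  intros HP.
  apply Filter_prod with (1 := at_right_0_pos) (2 := p_infty_pos); simpl.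
  intros a b Ha Hb x [Hx _]. apply HP.
  apply Rlt_le_trans with (2 := Hx). now apply Rmin_glb_lt.
Qed.

Lemma filter_prod_le :
  filter_prod (at_right 0) (Rbar_locally p_infty) (fun ab : R * R => fst ab <= snd ab).
Proof.
  apply Filter_prod with (fun a => a < 1) (fun b => 1 < b); simpl.
  - exists (mkposreal 1 Rlt_0_1). intros y Hy _.
    apply Rabs_def2 in Hy. unfold minus, plus, opp in Hy. simpl in Hy. lra.
  - now exists 1.
  - intros; lra.
Qed.

(** Comparison test through a primitive [G] of the dominating function: moving an endpoint changes
    [RInt f] by at most the increment of [G], so finite limits of [G] at both ends give the Cauchy
    criterion. *)
Lemma ex_RInt_gen_dominated (f g G : R -> R) (la lb : R) :
  (forall t, 0 < t -> continuous f t) ->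
  (forall t, 0 < t -> continuous g t) ->
  (forall t, 0 < t -> is_derive G t (g t)) ->
  (forall t, 0 < t -> Rabs (f t) <= g t) ->
  filterlim G (at_right 0) (locally la) ->
  filterlim G (Rbar_locally p_infty) (locally lb) ->
  ex_RInt_gen f (at_right 0) (Rbar_locally p_infty).
Proof.
  intros Cf Cg DG Hfg Ha Hb.
  assert (Ef : forall a b, 0 < a -> 0 < b -> ex_RInt f a b).
  { intros a b Pa Pb. apply (ex_RInt_continuous (V := R_CompleteNormedModule)).
    intros z [Hz _]. apply Cf. apply Rlt_le_trans with (2 := Hz). now apply Rmin_glb_lt. }
  assert (Ig : forall a b, 0 < a -> 0 < b -> is_RInt g a b (G b - G a)).
  { intros a b Pa Pb. apply (is_RInt_derive (V := R_CompleteNormedModule));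
    intros z [Hz _]; (apply DG || apply Cg);
    apply Rlt_le_trans with (2 := Hz); now apply Rmin_glb_lt. }
  assert (B0 : forall a b, 0 < a -> a <= b -> Rabs (RInt f a b) <= Rabs (G b - G a)).
  { intros a b Pa Pb. apply Rle_trans with (2 := Rle_abs _).
    apply (norm_RInt_le (V := R_NormedModule) f g a b); try assumption.
    - intros x Hx. apply Hfg. lra.
    - apply (RInt_correct (V := R_CompleteNormedModule)). apply Ef; lra.
    - apply Ig; lra. }
  assert (B : forall a b, 0 < a -> 0 < b -> Rabs (RInt f a b) <= Rabs (G b - G a)).
  { intros a b Pa Pb. destruct (Rle_lt_dec a b) as [L|L]; [now apply B0|].
    rewrite <- (opp_RInt_swap (V := R_CompleteNormedModule)) by now apply Ef.
    change (Rabs (- RInt f b a) <= Rabs (G b - G a)).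
    rewrite Rabs_Ropp, Rabs_minus_sym. apply B0; lra. }
  unfold ex_RInt_gen, is_RInt_gen.
  apply (filterlimi_locally_cauchy (U := R_CompleteSpace)).
  { apply Filter_prod with (1 := at_right_0_pos) (2 := p_infty_pos); simpl.
    intros a b Pa Pb. split.
    - now apply Ef.
    - intros y1 y2 H1 H2.
      apply (is_RInt_unique (V := R_CompleteNormedModule)) in H1.
      apply (is_RInt_unique (V := R_CompleteNormedModule)) in H2. congruence. }
  intros eps.
  (* Two endpoints move, and each move costs two distances to a limit of [G]. *)
  assert (P4 : 0 < eps / 4) by (generalize (cond_pos eps); lra).
  exists (fun ab : R * R => (Rabs (G (fst ab) - la) < eps / 4 /\ 0 < fst ab) /\
                            (Rabs (G (snd ab) - lb) < eps / 4 /\ 0 < snd ab)).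
  split.
  - apply Filter_prod with (fun a => Rabs (G a - la) < eps / 4 /\ 0 < a)
                           (fun b => Rabs (G b - lb) < eps / 4 /\ 0 < b); simpl.
    + apply filter_and; [|apply at_right_0_pos].
      apply (proj1 (filterlim_locally _ _) Ha (mkposreal _ P4)).
    + apply (filter_and (F := Rbar_locally p_infty)); [|apply p_infty_pos].
      apply (proj1 (filterlim_locally _ _) Hb (mkposreal _ P4)).
    + tauto.
  - intros [a b] [a' b'] [[Ha1 Pa] [Hb1 Pb]] [[Ha2 Pa'] [Hb2 Pb']] u v Hu Hv.
    simpl in *.
    apply (is_RInt_unique (V := R_CompleteNormedModule)) in Hu.
    apply (is_RInt_unique (V := R_CompleteNormedModule)) in Hv.
    assert (E1 : RInt f a' b' = RInt f a' a + (RInt f a b + RInt f b b')).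
    { rewrite <- (RInt_Chasles (V := R_CompleteNormedModule) f a' a b') by now apply Ef.
      rewrite <- (RInt_Chasles (V := R_CompleteNormedModule) f a b b') by now apply Ef.
      reflexivity. }
    change (Rabs (v - u) < eps).
    rewrite <- Hv, E1, Hu.
    replace (_ + _ - _) with (RInt f a' a + RInt f b b') by ring.
    apply Rle_lt_trans with (1 := Rabs_triang _ _).
    generalize (B a' a Pa' Pa) (B b b' Pb Pb').
    replace (G a - G a') with (G a - la + - (G a' - la)) by ring.
    replace (G b' - G b) with (G b' - lb + - (G b - lb)) by ring.
    generalize (Rabs_triang (G a - la) (- (G a' - la))) (Rabs_triang (G b' - lb) (- (G b - lb))).
    rewrite 2!Rabs_Ropp. lra.
Qed.

Lemma filterlim_Rpower_0 (x : R) : 0 < x ->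
  filterlim (fun t => Rpower t x) (at_right 0) (locally 0).
Proof.
  intros Hx. unfold Rpower.
  apply filterlim_comp with (G := Rbar_locally m_infty) (2 := is_lim_exp_m).
  apply filterlim_comp with (1 := is_lim_ln_0).
  replace m_infty with (Rbar_mult x m_infty) at 2.
  apply filterlim_Rbar_mult_l.
  simpl; destruct (Rle_dec 0 x); [destruct (Rle_lt_or_eq_dec 0 x r)|]; try reflexivity; exfalso; lra.
Qed.

Lemma filterlim_Rpower_p (x : R) : 0 < x ->
  filterlim (fun t => Rpower t x) (Rbar_locally p_infty) (Rbar_locally p_infty).
Proof.
  intros Hx. unfold Rpower.
  apply filterlim_comp with (G := Rbar_locally p_infty) (2 := is_lim_exp_p).
  apply filterlim_comp with (1 := is_lim_ln_p).
  replace p_infty with (Rbar_mult x p_infty) at 2.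
  apply filterlim_Rbar_mult_l.
  simpl; destruct (Rle_dec 0 x); [destruct (Rle_lt_or_eq_dec 0 x r)|]; try reflexivity; exfalso; lra.
Qed.

Lemma Rpower_pos (t x : R) : 0 < Rpower t x.
Proof. apply exp_pos. Qed.

(** The inequality [1 + ln (t / p) <= t / p] multiplied by [p], with a factor [exp (- p)] given
    away. *)
Lemma Rpower_le_exp (t p : R) : 0 < t -> 0 < p ->
  Rpower t p <= exp (p * ln p) * exp t.
Proof.
  intros Ht Hp. unfold Rpower. rewrite <- exp_plus.
  assert (E : p * ln t <= p * ln p + t).
  { assert (Q : 0 < t / p) by now apply Rdiv_lt_0_compat.
    generalize (exp_ineq1_le (ln (t / p))). rewrite exp_ln by assumption.
    unfold Rdiv at 1. rewrite ln_mult, ln_Rinv; try assumption; [|now apply Rinv_0_lt_compat].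
    intros H. apply Rmult_le_compat_l with (1 := Rlt_le _ _ Hp) in H.
    replace (p * (t / p)) with t in H by (field; lra). nra. }
  destruct E as [E|E]; [left; now apply exp_increasing|right; now rewrite E].
Qed.

Lemma is_derive_Rpower (t x : R) : 0 < t ->
  is_derive (fun t => Rpower t x) t (x * Rpower t (x - 1)).
Proof. intros Ht. apply is_derive_Reals. now apply derivable_pt_lim_power. Qed.

Lemma continuous_Gamma_integrand (x t : R) : 0 < t ->
  continuous (fun t => Rpower t (x - 1) * exp (- t)) t.
Proof.
  intros Ht. apply (ex_derive_continuous (V := R_NormedModule)).
  exists ((x - 1) * Rpower t (x - 1 - 1) * exp (- t) + Rpower t (x - 1) * (- exp (- t))).
  apply (is_derive_mult (fun t => Rpower t (x - 1)) (fun t => exp (- t))).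
  - now apply is_derive_Rpower.
  - auto_derive; trivial; ring.
  - intros; apply Rmult_comm.
Qed.

(* [-1 / (1 + t^x)] is a primitive, bounded on the half line, of a function dominating the
   integrand of [Gamma x]. *)
Lemma is_RInt_gen_Gamma (x : R) : 0 < x ->
  is_RInt_gen (fun t => Rpower t (x - 1) * exp (- t))
    (at_right 0) (Rbar_locally p_infty) (Gamma x).
Proof.
  intros Hx. apply (RInt_gen_correct (V := R_CompleteNormedModule)).
  (* With [y = t^x], [(1 + y)^2 <= 2 + 2 y^2], and [y^2 = t^(2x)] is at most [(2x)^(2x) exp t];
     hence [exp (- t) (1 + y)^2 <= K]. *)
  set (K := 2 + 2 * exp (2 * x * ln (2 * x))).
  set (g := fun t => K / x * (x * Rpower t (x - 1) / (1 + Rpower t x) ^ 2)).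
  assert (Q : forall t, 1 + Rpower t x <> 0) by (intros t; generalize (Rpower_pos t x); lra).
  apply ex_RInt_gen_dominated with (g := g) (G := fun t => K / x * (- / (1 + Rpower t x)))
     (la := K / x * (- / (1 + 0))) (lb := K / x * (- 0)).
  - intros t Ht. now apply continuous_Gamma_integrand.
  - intros t Ht. unfold g. apply (ex_derive_continuous (V := R_NormedModule)).
    auto_derive. repeat split; try (eexists; now apply is_derive_Rpower).
    apply Rmult_integral_contrapositive; split; [|rewrite Rmult_1_r]; apply Q.
  - intros t Ht. apply is_derive_scal.
    replace (x * Rpower t (x - 1) / (1 + Rpower t x) ^ 2)
      with (- (- (0 + x * Rpower t (x - 1)) / (1 + Rpower t x) ^ 2)) by (field; apply Q).
    apply (is_derive_opp (V := R_NormedModule)).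
    apply (is_derive_inv (fun t => 1 + Rpower t x)); [|apply Q].
    apply (is_derive_plus (V := R_NormedModule)); [apply (is_derive_const (V := R_NormedModule))|].
    now apply is_derive_Rpower.
  - intros t Ht. unfold g.
    rewrite Rabs_pos_eq by (apply Rmult_le_pos; left; apply exp_pos).
    replace (K / x * _) with (Rpower t (x - 1) * (K / (1 + Rpower t x) ^ 2))
      by (field; split; [apply Q|lra]).
    apply Rmult_le_compat_l; [left; apply exp_pos|].
    generalize (Rpower_pos t x); intros Pp.
    apply Rmult_le_reg_r with ((1 + Rpower t x) ^ 2); [apply pow_lt; lra|].
    unfold Rdiv. rewrite Rmult_assoc, Rinv_l, Rmult_1_r by (apply pow_nonzero, Q).
    assert (E : exp (- t) * exp t = 1) by (rewrite <- exp_plus, Rplus_opp_l; apply exp_0).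
    assert (H1 : Rpower t x ^ 2 <= exp (2 * x * ln (2 * x)) * exp t).
    { assert (E2 : Rpower t x ^ 2 = Rpower t (2 * x)).
      { replace (2 * x) with (x + x) by ring. rewrite Rpower_plus. ring. }
      rewrite E2. apply Rpower_le_exp; lra. }
    assert (H2 : 1 <= exp t) by (generalize (exp_ineq1_le t); lra).
    apply Rle_trans with (exp (- t) * (K * exp t)).
    2: { right. rewrite (Rmult_comm K), <- Rmult_assoc, E; ring. }
    apply Rmult_le_compat_l; [left; apply exp_pos|]. unfold K.
    generalize (pow2_ge_0 (1 - Rpower t x)). nra.
  - apply filterlim_comp with (G := locally 0) (1 := filterlim_Rpower_0 x Hx)
      (g := fun y => K / x * - / (1 + y)).
    apply (ex_derive_continuous (V := R_NormedModule) (fun y => K / x * - / (1 + y))).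
    auto_derive. lra.
  - apply filterlim_comp with (f := fun t => / (1 + Rpower t x)) (G := locally 0)
      (g := fun y => K / x * - y).
    2: { apply (ex_derive_continuous (V := R_NormedModule) (fun y => K / x * - y)).
         auto_derive. trivial. }
    apply filterlim_comp with (G := Rbar_locally p_infty) (g := Rinv).
    2: { apply (filterlim_Rbar_inv p_infty). discriminate. }
    apply filterlim_ge_p_infty with (2 := filterlim_Rpower_p x Hx).
    apply filter_forall. intros; lra.
Qed.

(** Integration by parts in one primitive: [- t^x exp (- t)] differentiates to the difference of the
    two integrands and vanishes at both ends. *)
Lemma Gamma_succ (x : R) : 0 < x -> Gamma (x + 1) = x * Gamma x.
Proof.
  intros Hx.
  set (f := fun t => - (Rpower t x * exp (- t))).
  assert (Df : forall t, 0 < t -> is_derive f t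
     (Rpower t (x + 1 - 1) * exp (- t) - x * (Rpower t (x - 1) * exp (- t)))).
  { intros t Ht.
    replace (_ - _) with (- (x * Rpower t (x - 1) * exp (- t) + Rpower t x * (- exp (- t))))
      by (replace (x + 1 - 1) with x by ring; ring).
    apply (is_derive_opp (V := R_NormedModule)).
    apply (is_derive_mult (fun t => Rpower t x) (fun t => exp (- t))).
    - now apply is_derive_Rpower.
    - auto_derive; trivial; ring.
    - intros; apply Rmult_comm. }
  assert (H1 : is_RInt_gen (Derive f) (at_right 0) (Rbar_locally p_infty) (- 0 - - (0 * exp (- 0)))).
  { apply is_RInt_gen_Derive.
    - apply filter_prod_pos. intros t Ht. eexists; now apply Df.
    - apply filter_prod_pos. intros t Ht.
      apply continuous_ext_loc with
        (fun t => Rpower t (x + 1 - 1) * exp (- t) - x * (Rpower t (x - 1) * exp (- t))).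
      + apply filter_imp with (fun t => 0 < t).
        * intros u Hu. symmetry. now apply is_derive_unique, Df.
        * now apply (open_gt 0).
      + apply (continuous_minus (V := R_NormedModule)).
        * now apply continuous_Gamma_integrand.
        * apply (continuous_scal_r (V := R_NormedModule)). now apply continuous_Gamma_integrand.
    - apply filterlim_comp with (f := fun t => Rpower t x * exp (- t)) (G := locally (0 * exp (- 0))).
      + apply (filterlim_comp_2 (H := locally (exp (-0))) (G := locally 0)
          (fun t => Rpower t x) (fun t => exp (- t)) Rmult).
        * now apply filterlim_Rpower_0.
        * apply (filterlim_filter_le_1 (F := locally 0)).
          { apply locally_within. }
          apply (ex_derive_continuous (V := R_NormedModule) (fun t => exp (- t))). auto_derive; trivial.
        * apply (filterlim_mult (K := R_AbsRing)).
      + apply (filterlim_opp (V := R_NormedModule)).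
    - apply filterlim_comp with (f := fun t => Rpower t x * exp (- t)) (G := locally 0).
      2: apply (filterlim_opp (V := R_NormedModule)).
      (* One exponent more than needed: [t^(x+1) <= C exp t] gives [t^x exp (- t) <= C / t], which
         tends to 0. *)
      set (C := exp ((x + 1) * ln (x + 1))).
      apply (filterlim_le_le (fun _ => 0) _ (fun t => C * / t) 0).
      + apply filter_imp with (2 := p_infty_pos). intros t Ht. split.
        * left; apply Rmult_lt_0_compat; apply exp_pos.
        * generalize (Rpower_le_exp t (x + 1) Ht ltac:(lra)). fold C.
          rewrite Rpower_plus, Rpower_1 by assumption. intros H.
          apply Rmult_le_reg_r with t; [assumption|]. rewrite exp_Ropp.
          generalize (exp_pos t). intros Pt.
          apply Rmult_le_reg_r with (exp t); [assumption|]. field_simplify; lra.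
      + apply (filterlim_const (U := R_UniformSpace)).
      + replace (Finite 0) with (Rbar_mult C (Rbar_inv p_infty)) by (simpl; f_equal; ring).
        apply (is_lim_scal_l (fun t => / t) C p_infty (Rbar_inv p_infty)).
        apply (filterlim_Rbar_inv p_infty). discriminate. }
  assert (H2 : is_RInt_gen (Derive f) (at_right 0) (Rbar_locally p_infty) (Gamma (x + 1) - x * Gamma x)).
  { apply is_RInt_gen_ext with
      (fun t => minus (Rpower t (x + 1 - 1) * exp (- t)) (scal x (Rpower t (x - 1) * exp (- t)))).
    - apply filter_imp with (2 := filter_prod_pos (fun t => 0 < t) (fun t Ht => Ht)).
      intros [a b] H t Ht. symmetry. apply is_derive_unique, Df. apply H. simpl in *; lra.
    - apply (is_RInt_gen_minus (V := R_NormedModule)).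
      + apply is_RInt_gen_Gamma; lra.
      + apply (is_RInt_gen_scal (V := R_NormedModule)). now apply is_RInt_gen_Gamma. }
  generalize (is_RInt_gen_unique (V := R_CompleteNormedModule) _ _ H1).
  rewrite (is_RInt_gen_unique (V := R_CompleteNormedModule) _ _ H2). lra.
Qed.

Lemma Gamma_unique (x l : R) :
  is_RInt_gen (fun t => Rpower t (x - 1) * exp (- t)) (at_right 0) (Rbar_locally p_infty) l ->
  Gamma x = l.
Proof.
  intros H. unfold Gamma.
  exact (is_RInt_gen_unique (V := R_CompleteNormedModule) _ _ H).
Qed.

Lemma RInt_gen_Rabs_le (f g : R -> R) (lf lg : R) :
  (forall t, 0 < t -> Rabs (f t) <= g t) ->
  is_RInt_gen f (at_right 0) (Rbar_locally p_infty) lf ->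
  is_RInt_gen g (at_right 0) (Rbar_locally p_infty) lg ->
  Rabs lf <= lg.
Proof.
  intros H Hf Hg.
  apply (RInt_gen_norm (V := R_CompleteNormedModule)
    (Fa := at_right 0) (Fb := Rbar_locally p_infty) f g lf lg); try assumption.
  - apply filter_prod_le.
  - generalize filter_prod_le (filter_prod_pos (fun t => Rabs (f t) <= g t) H). intros H1 H2.
    generalize (filter_and _ _ H1 H2). apply filter_imp.
    intros [a b] [H3 H4] x Hx. apply H4. simpl in *.
    rewrite Rmin_left, Rmax_right by assumption. exact Hx.
Qed.

Lemma is_RInt_gen_Rplus (f g : R -> R) (lf lg : R) :
  is_RInt_gen f (at_right 0) (Rbar_locally p_infty) lf ->
  is_RInt_gen g (at_right 0) (Rbar_locally p_infty) lg ->
  is_RInt_gen (fun t => f t + g t) (at_right 0) (Rbar_locally p_infty) (lf + lg).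
Proof. apply (is_RInt_gen_plus (V := R_NormedModule)). Qed.

Lemma is_RInt_gen_Rminus (f g : R -> R) (lf lg : R) :
  is_RInt_gen f (at_right 0) (Rbar_locally p_infty) lf ->
  is_RInt_gen g (at_right 0) (Rbar_locally p_infty) lg ->
  is_RInt_gen (fun t => f t - g t) (at_right 0) (Rbar_locally p_infty) (lf - lg).
Proof. apply (is_RInt_gen_minus (V := R_NormedModule)). Qed.

Lemma is_RInt_gen_Rscal (k : R) (f : R -> R) (lf : R) :
  is_RInt_gen f (at_right 0) (Rbar_locally p_infty) lf ->
  is_RInt_gen (fun t => k * f t) (at_right 0) (Rbar_locally p_infty) (k * lf).
Proof. apply (is_RInt_gen_scal (V := R_NormedModule)). Qed.

(** * Continuity of Gamma *)

Lemma exp_le (u v : R) : u <= v -> exp u <= exp v.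
Proof. intros [H|H]; [left; now apply exp_increasing|right; now rewrite H]. Qed.

Lemma Rpower_le_between (t p s q : R) : p <= s <= q ->
  Rpower t s <= Rpower t p + Rpower t q.
Proof.
  intros Hs. unfold Rpower. generalize (exp_pos (p * ln t)) (exp_pos (q * ln t)). intros P Q.
  destruct (Rle_lt_dec 0 (ln t)) as [L|L].
  - assert (exp (s * ln t) <= exp (q * ln t)) by (apply exp_le; nra). lra.
  - assert (exp (s * ln t) <= exp (p * ln t)) by (apply exp_le; nra). lra.
Qed.

(** The tangent line inequality [exp v >= (1 + v - u) exp u] for [v <= u]; the sum on the right
    makes the bound symmetric. *)
Lemma Rabs_exp_minus_le (u v : R) :
  Rabs (exp u - exp v) <= Rabs (u - v) * (exp u + exp v).
Proof.
  assert (H : forall u v, v <= u -> Rabs (exp u - exp v) <= Rabs (u - v) * (exp u + exp v)).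
  { clear. intros u v L. generalize (exp_le _ _ L) (exp_pos u) (exp_pos v). intros.
    rewrite !Rabs_pos_eq by lra.
    generalize (exp_ineq1_le (v - u)). intros E.
    apply Rmult_le_compat_r with (r := exp u) in E; [|lra].
    rewrite <- exp_plus in E. replace (v - u + u) with v in E by ring. nra. }
  destruct (Rle_lt_dec v u) as [L|L]; [now apply H|].
  rewrite Rabs_minus_sym, (Rabs_minus_sym u), Rplus_comm. apply H; lra.
Qed.

Lemma Rabs_ln_le (t : R) : 0 < t -> Rabs (ln t) <= t + / t.
Proof.
  intros Ht. assert (Pt : 0 < / t) by now apply Rinv_0_lt_compat.
  generalize (exp_ineq1_le (ln t)) (exp_ineq1_le (ln (/ t))).
  rewrite !exp_ln, ln_Rinv by assumption. intros. apply Rabs_le; lra.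
Qed.

(** The integrands differ by at most [|y - x| |ln t|] times the sum of the two powers. Each power is
    below [t^(p-1) + t^(q-1)], whence the factor 2, and [|ln t| <= t + 1/t] shifts the arguments of
    [Gamma] by one both ways; [1 < p] keeps [p - 1] positive. *)
Lemma Gamma_Lipschitz (p q x y : R) : 1 < p -> p <= x <= q -> p <= y <= q ->
  Rabs (Gamma y - Gamma x)
    <= Rabs (y - x) * 2 * (Gamma (p + 1) + Gamma (p - 1) + (Gamma (q + 1) + Gamma (q - 1))).
Proof.
  intros Hp Hx Hy.
  set (G s t := Rpower t (s - 1) * exp (- t)).
  assert (IG : forall s, 0 < s ->
    is_RInt_gen (G s) (at_right 0) (Rbar_locally p_infty) (Gamma s))
    by (intros; now apply is_RInt_gen_Gamma).
  apply RInt_gen_Rabs_le with (f := fun t => G y t - G x t)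
    (g := fun t => Rabs (y - x) * 2 * (G (p + 1) t + G (p - 1) t + (G (q + 1) t + G (q - 1) t))).
  2: apply is_RInt_gen_Rminus; apply IG; lra.
  2: { apply is_RInt_gen_Rscal.
       apply (is_RInt_gen_Rplus (fun t => G (p + 1) t + G (p - 1) t));
       apply (is_RInt_gen_Rplus (G _)); apply IG; lra. }
  intros t Ht. unfold G.
  rewrite <- Rmult_minus_distr_r, Rabs_mult, (Rabs_pos_eq (exp _)) by (left; apply exp_pos).
  rewrite <- !Rmult_plus_distr_r, <- Rmult_assoc.
  apply Rmult_le_compat_r; [left; apply exp_pos|].
  assert (E : forall s, Rpower t (s + 1 - 1) + Rpower t (s - 1 - 1) = (t + / t) * Rpower t (s - 1)).
  { intros s. replace (s + 1 - 1) with (s - 1 + 1) by ring.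
    replace (s - 1 - 1) with (s - 1 + - (1)) by ring.
    rewrite !Rpower_plus, Rpower_Ropp, Rpower_1 by assumption. ring. }
  rewrite !E, <- Rmult_plus_distr_l.
  generalize (Rpower_le_between t (p - 1) (x - 1) (q - 1) ltac:(lra))
             (Rpower_le_between t (p - 1) (y - 1) (q - 1) ltac:(lra)). intros H1 H2.
  apply Rle_trans with (1 := Rabs_exp_minus_le _ _).
  replace ((y - 1) * ln t - (x - 1) * ln t) with ((y - x) * ln t) by ring.
  rewrite Rabs_mult, !Rmult_assoc. apply Rmult_le_compat_l; [apply Rabs_pos|].
  rewrite <- (Rmult_assoc 2), (Rmult_comm 2), Rmult_assoc.
  apply Rmult_le_compat.
  - apply Rabs_pos.
  - left; apply Rplus_lt_0_compat; apply exp_pos.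
  - now apply Rabs_ln_le.
  - fold (Rpower t (y - 1)) (Rpower t (x - 1)). lra.
Qed.

(** The Lipschitz bound works above 1; the recurrence [Gamma y = Gamma (y + 1) / y] then carries
    continuity down to all positive arguments. *)
Lemma continuous_Gamma (x : R) : 0 < x -> continuous Gamma x.
Proof.
  intros Hx0.
  assert (H : forall x, 1 < x -> continuous Gamma x).
  { clear. intros x Hx.
    (* Half the distance to 1, so that [p = x - d] still exceeds 1. *)
    set (d := (x - 1) / 2).
    set (K := 2 * (Gamma (x - d + 1) + Gamma (x - d - 1) + (Gamma (x + d + 1) + Gamma (x + d - 1)))).
    apply filterlim_locally. intros eps.
    assert (PK : 0 < Rabs K + 1) by (generalize (Rabs_pos K); lra).
    assert (Pd : 0 < Rmin d (eps / (Rabs K + 1))).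
    { apply Rmin_glb_lt; [unfold d; lra|]. apply Rdiv_lt_0_compat; [apply cond_pos|assumption]. }
    exists (mkposreal _ Pd). intros y Hy. change (Rabs (y - x) < Rmin d (eps / (Rabs K + 1))) in Hy.
    change (Rabs (Gamma y - Gamma x) < eps).
    generalize (Rlt_le_trans _ _ _ Hy (Rmin_l _ _)) (Rlt_le_trans _ _ _ Hy (Rmin_r _ _)).
    intros H1 H2.
    assert (H3 := H1). apply Rabs_def2 in H3.
    apply Rle_lt_trans with (Rabs (y - x) * 2 *
      (Gamma (x - d + 1) + Gamma (x - d - 1) + (Gamma (x + d + 1) + Gamma (x + d - 1)))).
    { apply Gamma_Lipschitz; unfold d in *; lra. }
    rewrite Rmult_assoc. fold K.
    apply Rle_lt_trans with (Rabs (y - x) * (Rabs K + 1)).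
    { apply Rmult_le_compat_l; [apply Rabs_pos|]. generalize (Rle_abs K); lra. }
    apply Rmult_lt_reg_r with (/ (Rabs K + 1)); [now apply Rinv_0_lt_compat|].
    rewrite Rmult_assoc, Rinv_r, Rmult_1_r by lra. exact H2. }
  apply continuous_ext_loc with (fun y => / y * Gamma (y + 1)).
  - apply filter_imp with (fun t => 0 < t); [|now apply (open_gt 0)].
    intros y Hy. rewrite Gamma_succ, <- Rmult_assoc, Rinv_l by lra. apply Rmult_1_l.
  - apply (continuous_mult (K := R_AbsRing)).
    + apply (ex_derive_continuous (V := R_NormedModule) Rinv). auto_derive. lra.
    + apply (continuous_comp (fun y => y + 1) Gamma).
      * apply (ex_derive_continuous (V := R_NormedModule) (fun y => y + 1)). auto_derive. trivial.
      * apply H. lra.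
Qed.

(** * The value of Gamma at 1 and a lower bound on [2, 4] *)

Lemma Gamma_1 : Gamma 1 = 1.
Proof.
  apply Gamma_unique.
  assert (D : forall t, is_derive (fun t => - exp (- t)) t (exp (- t)))
    by (intros; auto_derive; trivial; ring).
  apply is_RInt_gen_ext with (Derive (fun t => - exp (- t))).
  - generalize (filter_prod_pos (fun t => 0 < t) (fun t Ht => Ht)). apply filter_imp.
    intros [a b] H t Ht. transitivity (exp (- t)); [apply is_derive_unique, D|].
    rewrite Rminus_diag_eq by reflexivity. rewrite Rpower_O; [symmetry; apply Rmult_1_l|].
    apply H. simpl in *; lra.
  - replace 1 with (- 0 - - exp (- 0)) by (rewrite Ropp_0, exp_0; ring).
    apply is_RInt_gen_Derive.
    + apply filter_prod_pos. intros t Ht. eexists; apply D.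
    + apply filter_prod_pos. intros t Ht.
      apply continuous_ext with (fun t => exp (- t)).
      * intros u. symmetry. apply is_derive_unique, D.
      * apply (ex_derive_continuous (V := R_NormedModule)). auto_derive. trivial.
    + apply (filterlim_filter_le_1 (F := locally 0)).
      { apply locally_within. }
      apply (ex_derive_continuous (V := R_NormedModule) (fun t => - exp (- t))).
      auto_derive. trivial.
    + apply filterlim_comp with (f := fun t => exp (- t)) (G := locally 0).
      2: apply (filterlim_opp (V := R_NormedModule)).
      apply filterlim_comp with (G := Rbar_locally m_infty).
      * apply (filterlim_Rbar_opp p_infty).
      * apply is_lim_exp_m.
Qed.

(* [t^(x-1) >= t - 1/2] on the half line, and the latter integrates to [Gamma 2 - Gamma 1 / 2]. *)
Lemma Gamma_ge_half (x : R) : 2 <= x <= 4 -> / 2 <= Gamma x.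
Proof.
  intros Hx.
  set (h := fun t => Rpower t (2 - 1) * exp (- t) - / 2 * (Rpower t (1 - 1) * exp (- t))).
  assert (Ih : is_RInt_gen h (at_right 0) (Rbar_locally p_infty) (/ 2)).
  { assert (E : Gamma 2 - / 2 * Gamma 1 = / 2).
    { replace 2 with (1 + 1) at 1 by ring. rewrite Gamma_succ, Gamma_1 by lra. field. }
    rewrite <- E. unfold h.
    apply is_RInt_gen_Rminus; [|apply is_RInt_gen_Rscal]; apply is_RInt_gen_Gamma; lra. }
  enough (B : forall t, 0 < t -> Rabs (Rpower t (x - 1) * exp (- t) - h t)
                         <= Rpower t (x - 1) * exp (- t) - h t).
  { assert (J := is_RInt_gen_Rminus _ _ _ _ (is_RInt_gen_Gamma x ltac:(lra)) Ih).
    generalize (Rabs_pos (Gamma x - / 2)) (RInt_gen_Rabs_le _ _ _ _ B J J). lra. }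
  clear -Hx. intros t Ht. right. apply Rabs_pos_eq. unfold h.
  replace (2 - 1) with 1 by ring. replace (1 - 1) with 0 by ring.
  rewrite Rpower_1, Rpower_O by assumption.
  replace (Rpower t (x - 1) * exp (- t) - _) with ((Rpower t (x - 1) - (t - / 2)) * exp (- t)) by ring.
  apply Rmult_le_pos; [|left; apply exp_pos].
  destruct (Rle_lt_dec 1 t) as [L|L].
  - assert (t <= Rpower t (x - 1)); [|lra].
    rewrite <- (Rpower_1 t) at 1 by assumption. apply Rle_Rpower; lra.
  - assert (E : t ^ 3 <= Rpower t (x - 1)).
    { rewrite <- Rpower_pow by assumption. apply exp_le. simpl INR.
      assert (ln t < 0) by (rewrite <- ln_1; now apply ln_increasing). nra. }
    (* The tangent to [t^3] at [3/5]: the product expands to [t^3 - 1.08 t + 0.432], and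
       [1.08 t - 0.432] exceeds [t - 1/2] for positive [t]. *)
    assert (0 <= (t - 6 / 10) ^ 2 * (t + 12 / 10)) by (apply Rmult_le_pos; [apply pow2_ge_0|lra]).
    nra.
Qed.

(** * The Gaussian integral and Gamma(1/2) *)

Lemma continuous_gauss (u : R) : continuous (fun u => exp (- u ^ 2)) u.
Proof. apply (ex_derive_continuous (V := R_NormedModule)). auto_derive. trivial. Qed.

Lemma ex_RInt_gauss (a b : R) : ex_RInt (fun u => exp (- u ^ 2)) a b.
Proof.
  apply (ex_RInt_continuous (V := R_CompleteNormedModule)). intros. apply continuous_gauss.
Qed.

Lemma is_derive_RInt_gauss (x : R) :
  is_derive (fun x => RInt (fun u => exp (- u ^ 2)) 0 x) x (exp (- x ^ 2)).
Proof.
  apply (is_derive_RInt (V := R_NormedModule) (fun u => exp (- u ^ 2)) _ 0).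
  - apply filter_forall. intros y. apply (RInt_correct (V := R_CompleteNormedModule)), ex_RInt_gauss.
  - apply continuous_gauss.
Qed.

(** The companion integral of the classical one-variable evaluation of the Gaussian integral: an
    arctangent integral at [x = 0], vanishing as [x] grows. *)
Definition gauss_rest (x : R) : R :=
  RInt (fun t => exp (- (x ^ 2 * (1 + t ^ 2))) / (1 + t ^ 2)) 0 1.

Lemma one_plus_sqr_pos (t : R) : 0 < 1 + t ^ 2.
Proof. generalize (pow2_ge_0 t); lra. Qed.

Lemma ex_RInt_gauss_rest (x : R) :
  ex_RInt (fun t => exp (- (x ^ 2 * (1 + t ^ 2))) / (1 + t ^ 2)) 0 1.
Proof.
  apply (ex_RInt_continuous (V := R_CompleteNormedModule)). intros t _.
  apply (ex_derive_continuous (V := R_NormedModule)). auto_derive.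
  generalize (one_plus_sqr_pos t). simpl. lra.
Qed.

(** Differentiating under the integral cancels [1 + t^2] and leaves
    [- 2 x exp (- x^2) exp (- (x t)^2)]; the substitution [u = x t] absorbs the factor [x]. *)
Lemma is_derive_gauss_rest (x : R) :
  is_derive gauss_rest x (- 2 * exp (- x ^ 2) * RInt (fun u => exp (- u ^ 2)) 0 x).
Proof.
  assert (D : forall u t, is_derive (fun u => exp (- (u ^ 2 * (1 + t ^ 2))) / (1 + t ^ 2)) u
     (- 2 * u * exp (- (u ^ 2 * (1 + t ^ 2))))).
  { intros u t. generalize (one_plus_sqr_pos t). intros P. auto_derive; [simpl in P; lra|].
    simpl in *. field. simpl; lra. }
  replace (- 2 * exp (- x ^ 2) * _) with
    (RInt (fun t => Derive (fun u => exp (- (u ^ 2 * (1 + t ^ 2))) / (1 + t ^ 2)) x) 0 1).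
  - apply (is_derive_RInt_param (fun u t => exp (- (u ^ 2 * (1 + t ^ 2))) / (1 + t ^ 2))).
    + apply filter_forall. intros u t _. eexists; apply D.
    + intros t _.
      apply continuity_2d_pt_ext with (fun u v => - 2 * u * exp (- (u ^ 2 * (1 + v ^ 2)))).
      { intros u v. symmetry. apply is_derive_unique, D. }
      apply continuity_2d_pt_mult.
      * apply continuity_2d_pt_mult; [apply continuity_2d_pt_const|apply continuity_2d_pt_id1].
      * apply (continuity_1d_2d_pt_comp exp (fun u v => - (u ^ 2 * (1 + v ^ 2)))).
        { apply derivable_continuous_pt, derivable_pt_exp. }
        apply continuity_2d_pt_opp, continuity_2d_pt_mult.
        -- apply (continuity_1d_2d_pt_comp (fun z => z ^ 2) (fun u v => u)).
           { apply continuity_pt_filterlim.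
             match goal with |- filterlim ?f _ _ =>
               apply (ex_derive_continuous (V := R_NormedModule) f) end.
             auto_derive; trivial. }
           apply continuity_2d_pt_id1.
        -- apply (continuity_1d_2d_pt_comp (fun z => 1 + z ^ 2) (fun u v => v)).
           { apply continuity_pt_filterlim.
             match goal with |- filterlim ?f _ _ =>
               apply (ex_derive_continuous (V := R_NormedModule) f) end.
             auto_derive; trivial. }
           apply continuity_2d_pt_id2.
    + apply filter_forall. intros u. apply ex_RInt_gauss_rest.
  (* The [+ 0] puts the integrand in the affine form expected by [RInt_comp_lin]. *)
  - rewrite (RInt_ext _ (fun t => scal (- 2 * exp (- x ^ 2)) (x * exp (- (x * t + 0) ^ 2)))).
    2: { intros t _.
         transitivity (- 2 * x * exp (- (x ^ 2 * (1 + t ^ 2)))); [apply is_derive_unique, D|].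
         replace (- (x ^ 2 * (1 + t ^ 2))) with (- x ^ 2 + - (x * t + 0) ^ 2) by ring.
         rewrite exp_plus. unfold scal. simpl. unfold mult. simpl. ring. }
    rewrite (RInt_scal (V := R_CompleteNormedModule)).
    2: { apply (ex_RInt_comp_lin (V := R_NormedModule) (fun u => exp (- u ^ 2)) x 0 0 1).
         apply ex_RInt_gauss. }
    unfold scal; simpl; unfold mult; simpl. f_equal.
    transitivity (RInt (fun u => exp (- u ^ 2)) (x * 0 + 0) (x * 1 + 0)).
    + apply (RInt_comp_lin (V := R_CompleteNormedModule) (fun u => exp (- u ^ 2)) x 0 0 1).
      apply ex_RInt_gauss.
    + f_equal; ring.
Qed.

Lemma gauss_rest_0 : gauss_rest 0 = PI / 4.
Proof.
  unfold gauss_rest.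
  replace (PI / 4) with (atan 1 - atan 0) by (rewrite atan_1, atan_0; ring).
  apply (is_RInt_unique (V := R_CompleteNormedModule)).
  apply (is_RInt_ext (V := R_NormedModule)) with (fun t => / (1 + t ^ 2)).
  { intros t _. replace (- (0 ^ 2 * (1 + t ^ 2))) with 0 by ring.
    rewrite exp_0. unfold Rdiv. now rewrite Rmult_1_l. }
  apply (is_RInt_derive (V := R_CompleteNormedModule)).
  - intros t _. apply is_derive_Reals.
    apply derivable_pt_lim_atan.
  - intros t _. apply (ex_derive_continuous (V := R_NormedModule)). auto_derive.
    generalize (one_plus_sqr_pos t). simpl. lra.
Qed.

Lemma constant_of_derive_0 (f : R -> R) :
  (forall x, is_derive f x 0) -> forall x, f x = f 0.
Proof.
  intros D x. destruct (MVT_gen f 0 x (fun _ => 0)) as [c [_ Hc]].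
  - intros; apply D.
  - intros y _. apply continuity_pt_filterlim.
    apply (ex_derive_continuous (V := R_NormedModule) f). eexists; apply D.
  - lra.
Qed.

(* The derivatives of the two terms cancel, so the sum keeps its value at [0]. *)
Lemma gauss_rest_eq (x : R) :
  RInt (fun u => exp (- u ^ 2)) 0 x ^ 2 + gauss_rest x = PI / 4.
Proof.
  set (E := fun x => RInt (fun u => exp (- u ^ 2)) 0 x : R).
  assert (D : forall x, is_derive (fun x => E x ^ 2 + gauss_rest x) x 0).
  { intros y.
    replace 0 with (INR 2 * exp (- y ^ 2) * E y ^ 1 + - 2 * exp (- y ^ 2) * E y)
      by (simpl; ring).
    apply (is_derive_plus (V := R_NormedModule) (fun x => E x ^ 2) gauss_rest).
    - apply is_derive_pow, is_derive_RInt_gauss.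
    - apply is_derive_gauss_rest. }
  generalize (constant_of_derive_0 _ D x). unfold E at 2.
  rewrite (RInt_point (V := R_CompleteNormedModule)), gauss_rest_0.
  change (zero : R) with 0. fold (E x). lra.
Qed.

Lemma gauss_rest_bound (x : R) : 0 <= gauss_rest x <= exp (- x ^ 2).
Proof.
  unfold gauss_rest.
  assert (B : forall t, 0 <= exp (- (x ^ 2 * (1 + t ^ 2))) / (1 + t ^ 2) <= exp (- x ^ 2)).
  { intros t. generalize (one_plus_sqr_pos t) (pow2_ge_0 t) (pow2_ge_0 x). intros P1 P2 P3.
    split.
    - apply Rmult_le_pos; [left; apply exp_pos|left; now apply Rinv_0_lt_compat].
    - rewrite <- (Rmult_1_r (exp (- x ^ 2))). apply Rmult_le_compat.
      + left; apply exp_pos.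
      + left; now apply Rinv_0_lt_compat.
      + assert (L : - (x ^ 2 * (1 + t ^ 2)) <= - x ^ 2) by nra.
        destruct L as [L|L]; [left; now apply exp_increasing|right; now rewrite L].
      + rewrite <- Rinv_1 at 2. apply Rinv_le_contravar; lra. }
  split.
  - apply RInt_ge_0; [lra|apply ex_RInt_gauss_rest|]. intros; apply B.
  - replace (exp (- x ^ 2)) with (RInt (fun _ => exp (- x ^ 2)) 0 1).
    + apply RInt_le; [lra|apply ex_RInt_gauss_rest|apply ex_RInt_const|]. intros; apply B.
    + rewrite RInt_const. unfold scal; simpl; unfold mult; simpl. ring.
Qed.

Lemma RInt_gauss_ge_0 (x : R) : 0 <= x -> 0 <= RInt (fun u => exp (- u ^ 2)) 0 x.
Proof.
  intros Hx. apply RInt_ge_0; [assumption|apply ex_RInt_gauss|]. intros; left; apply exp_pos.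
Qed.

(** Taken along [sqrt t] because the substitution [t = u^2] turns the integral of [Gamma (1/2)] into
    twice the Gaussian one. *)
Lemma lim_RInt_gauss :
  filterlim (fun t => RInt (fun u => exp (- u ^ 2)) 0 (sqrt t))
    (Rbar_locally p_infty) (locally (sqrt PI / 2)).
Proof.
  replace (sqrt PI / 2) with (sqrt (PI / 4)).
  2: { rewrite sqrt_div_alt by lra. replace 4 with (2 * 2) by ring. now rewrite sqrt_square by lra. }
  apply filterlim_ext_loc with (fun t => sqrt (PI / 4 - gauss_rest (sqrt t))).
  { apply (filter_imp (fun t => 0 < t)); [|apply p_infty_pos]. intros t Ht.
    rewrite <- (gauss_rest_eq (sqrt t)). unfold Rminus. rewrite Rplus_assoc, Rplus_opp_r, Rplus_0_r.
    apply sqrt_pow2, RInt_gauss_ge_0, sqrt_pos. }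
  apply filterlim_comp with (f := fun t => gauss_rest (sqrt t)) (G := locally 0)
    (g := fun y => sqrt (PI / 4 - y)).
  - apply (filterlim_le_le (fun _ => 0) _ (fun t => exp (- t)) 0).
    + apply (filter_imp (fun t => 0 < t)); [|apply p_infty_pos]. intros t Ht.
      generalize (gauss_rest_bound (sqrt t)). now rewrite pow2_sqrt by lra.
    + apply (filterlim_const (U := R_UniformSpace)).
    + apply filterlim_comp with (G := Rbar_locally m_infty).
      * apply (filterlim_Rbar_opp p_infty).
      * apply is_lim_exp_m.
  - replace (sqrt (PI / 4)) with (sqrt (PI / 4 - 0)) by (f_equal; ring).
    apply (continuous_comp (fun y => PI / 4 - y) sqrt).
    + apply (ex_derive_continuous (V := R_NormedModule)). auto_derive. trivial.
    + apply continuous_sqrt.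
Qed.

Lemma Gamma_half : Gamma (/ 2) = sqrt PI.
Proof.
  apply Gamma_unique.
  set (F := fun t => 2 * RInt (fun u => exp (- u ^ 2)) 0 (sqrt t)).
  assert (D : forall t, 0 < t -> is_derive F t (Rpower t (/ 2 - 1) * exp (- t))).
  { intros t Ht. unfold F.
    replace (Rpower t (/ 2 - 1) * exp (- t)) with (2 * (/ (2 * sqrt t) * exp (- (sqrt t) ^ 2))).
    - apply is_derive_scal.
      apply (is_derive_comp (V := R_NormedModule) (fun x => RInt (fun u => exp (- u ^ 2)) 0 x) sqrt).
      + apply is_derive_RInt_gauss.
      + apply is_derive_Reals. now apply derivable_pt_lim_sqrt.
    - rewrite pow2_sqrt by lra. replace (/ 2 - 1) with (- / 2) by field.
      rewrite Rpower_Ropp, Rpower_sqrt by assumption.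
      field. apply Rgt_not_eq. now apply sqrt_lt_R0. }
  apply is_RInt_gen_ext with (Derive F).
  - generalize (filter_prod_pos (fun t => 0 < t) (fun t Ht => Ht)). apply filter_imp.
    intros [a b] H t Ht. apply is_derive_unique, D. apply H. simpl in *; lra.
  - replace (sqrt PI) with (2 * (sqrt PI / 2) - F 0).
    2: { unfold F. rewrite sqrt_0, (RInt_point (V := R_CompleteNormedModule)).
         change (zero : R) with 0. field. }
    apply is_RInt_gen_Derive.
    + apply filter_prod_pos. intros t Ht. eexists; now apply D.
    + apply filter_prod_pos. intros t Ht.
      apply continuous_ext_loc with (fun t => Rpower t (/ 2 - 1) * exp (- t)).
      * apply filter_imp with (fun t => 0 < t); [|now apply (open_gt 0)].
        intros u Hu. symmetry. now apply is_derive_unique, D.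
      * now apply continuous_Gamma_integrand.
    + apply (filterlim_filter_le_1 (F := locally 0)).
      { apply locally_within. }
      apply (continuous_scal_r (V := R_NormedModule) 2
        (fun t => RInt (fun u => exp (- u ^ 2)) 0 (sqrt t))).
      apply (continuous_comp sqrt (fun x => RInt (fun u => exp (- u ^ 2)) 0 x)).
      * apply continuous_sqrt.
      * apply (ex_derive_continuous (V := R_NormedModule)). eexists; apply is_derive_RInt_gauss.
    + apply filterlim_comp with (1 := lim_RInt_gauss).
      apply (filterlim_scal_r (V := R_NormedModule) 2 (sqrt PI / 2)).
Qed.

(** * The reciprocal Gamma function *)

Lemma poch_Gamma_shift (z : R) (N k : nat) : 0 < z + INR N ->
  poch z (N + k) / Gamma (z + INR (N + k)) = poch z N / Gamma (z + INR N).
Proof.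
  intros H. induction k as [|k IH]; [now rewrite Nat.add_0_r|].
  assert (P : 0 < z + INR (N + k)) by (rewrite plus_INR; generalize (pos_INR k); lra).
  rewrite <- IH, Nat.add_succ_r, S_INR. simpl poch.
  rewrite <- Rplus_assoc, Gamma_succ by assumption.
  unfold Rdiv. rewrite Rinv_mult, Rmult_assoc, <- (Rmult_assoc (z + INR (N + k))).
  rewrite Rinv_r by lra. now rewrite Rmult_1_l.
Qed.

(** Independence of the shift: the definition picks one by [up], but two admissible shifts [M] and
    [N] agree at the common shift [M + N]. One [N] can then serve a whole neighbourhood. *)
Lemma rgamma_poch (z : R) (N : nat) : 0 < z + INR N ->
  rgamma z = poch z N / Gamma (z + INR N).
Proof.
  intros H. unfold rgamma. set (M := (Z.to_nat (up (- z)) + 1)%nat).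
  assert (HM : 0 < z + INR M).
  { unfold M. rewrite plus_INR. simpl (INR 1).
    destruct (archimed (- z)) as [A _].
    destruct (Z.le_gt_cases 0 (up (- z))) as [L|L].
    - rewrite INR_IZR_INZ, Z2Nat.id by assumption. lra.
    - generalize (pos_INR (Z.to_nat (up (- z)))). apply IZR_lt in L. lra. }
  rewrite <- (poch_Gamma_shift z M N HM), <- (poch_Gamma_shift z N M H).
  now rewrite Nat.add_comm.
Qed.

Lemma rgamma_Rinv (x : R) : 0 < x -> rgamma x = / Gamma x.
Proof.
  intros Hx. rewrite (rgamma_poch x 0) by (simpl; lra). simpl. unfold Rdiv.
  now rewrite Rplus_0_r, Rmult_1_l.
Qed.

Lemma poch_succ_l (z : R) (n : nat) : poch z (S n) = z * poch (z + 1) n.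
Proof.
  induction n as [|n IH]; [simpl; ring|].
  change (poch z (S n) * (z + INR (S n)) = z * (poch (z + 1) n * (z + 1 + INR n))).
  rewrite IH, S_INR. ring.
Qed.

Lemma exists_nat_shift (z b : R) : z <= b -> exists N, b < z + INR N <= b + 1.
Proof.
  intros H. destruct (archimed (b - z)) as [A1 A2].
  exists (Z.to_nat (up (b - z))).
  assert (0 <= up (b - z))%Z by (apply le_IZR; lra).
  rewrite INR_IZR_INZ, Z2Nat.id by assumption. lra.
Qed.

Lemma rgamma_succ (z : R) : rgamma z = z * rgamma (z + 1).
Proof.
  destruct (exists_nat_shift z (Rmax z 0) (Rmax_l _ _)) as [N [H _]].
  assert (P : 0 < z + INR N) by (generalize (Rmax_r z 0); lra).
  assert (E : z + 1 + INR N = z + INR (S N)) by (rewrite S_INR; ring).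
  rewrite (rgamma_poch z (S N)), (rgamma_poch (z + 1) N), E, poch_succ_l.
  - unfold Rdiv. ring.
  - lra.
  - rewrite S_INR. lra.
Qed.

Lemma continuous_poch (n : nat) (z : R) : continuous (fun z => poch z n) z.
Proof.
  induction n as [|n IH]; simpl.
  - apply continuous_const.
  - apply (continuous_mult (K := R_AbsRing) (fun z => poch z n) (fun z => z + INR n)).
    + assumption.
    + apply (continuous_plus (V := R_NormedModule)); [apply continuous_id|apply continuous_const].
Qed.

(** A fixed shift takes [z] into [(2, 3]], where [Gamma] is continuous and at least [1/2]. The range
    [z <= 2] contains every [n a + b] with [a <= 0] and [b <= 1]. *)
Lemma continuous_rgamma (z : R) : z <= 2 -> continuous rgamma z.
Proof.
  intros Hz. destruct (exists_nat_shift z 2 Hz) as [N [H1 H2]].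
  apply continuous_ext_loc with (fun z => poch z N * / Gamma (z + INR N)).
  - apply filter_imp with (fun y => - INR N < y); [|apply (open_gt (- INR N)); lra].
    intros y Hy. symmetry. apply rgamma_poch. lra.
  - apply (continuous_mult (K := R_AbsRing)); [apply continuous_poch|].
    apply (continuous_comp (fun z => Gamma (z + INR N)) Rinv).
    + apply (continuous_comp (fun z => z + INR N) Gamma).
      * apply (continuous_plus (V := R_NormedModule)); [apply continuous_id|apply continuous_const].
      * apply continuous_Gamma. lra.
    + apply (ex_derive_continuous (V := R_NormedModule) Rinv). auto_derive.
      generalize (Gamma_ge_half (z + INR N) ltac:(lra)). lra.
Qed.

(** A shift by 3 lands in [[5/2, 4]]: the three factors are at most 1, 2, 3 and [1 / Gamma] is at
    most 2. *)
Lemma Rabs_rgamma_le_12 (z : R) : - / 2 <= z <= 1 -> Rabs (rgamma z) <= 12.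
Proof.
  intros Hz. rewrite (rgamma_poch z 3) by (simpl; lra). simpl INR.
  generalize (Gamma_ge_half (z + (1 + 1 + 1)) ltac:(lra)). intros H.
  unfold Rdiv. rewrite Rabs_mult.
  replace 12 with (6 * 2) by ring. apply Rmult_le_compat; try apply Rabs_pos.
  - simpl. rewrite !Rabs_mult, Rabs_R1, Rmult_1_l.
    replace 6 with (1 * 2 * 3) by ring.
    repeat apply Rmult_le_compat; try apply Rabs_pos;
    try (apply Rmult_le_pos; apply Rabs_pos); apply Rabs_le; lra.
  - rewrite Rabs_pos_eq by (left; apply Rinv_0_lt_compat; lra).
    rewrite <- (Rinv_inv 2). apply Rinv_le_contravar; lra.
Qed.

(** Raising [n] by 2 extends the range by one unit to the left, which costs one use of the
    recurrence and a factor [|z| <= n + 2]. With [m = div2 n], the right side grows by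
    [(n + 2) (n + 1) / (m + 1)], which is at least [n + 2]. *)
Lemma Rabs_rgamma_le (n : nat) (z : R) : - INR n / 2 <= z <= 1 ->
  Rabs (rgamma z) <= 12 * (INR (Factorial.fact n) / INR (Factorial.fact (Nat.div2 n))).
Proof.
  revert z.
  (* The step goes from [n] to [n + 2], so the induction carries two consecutive indices. *)
  enough (H : forall n, (forall z, - INR n / 2 <= z <= 1 ->
      Rabs (rgamma z) <= 12 * (INR (Factorial.fact n) / INR (Factorial.fact (Nat.div2 n)))) /\
     (forall z, - INR (S n) / 2 <= z <= 1 -> Rabs (rgamma z)
       <= 12 * (INR (Factorial.fact (S n)) / INR (Factorial.fact (Nat.div2 (S n))))))
    by apply (H n).
  clear n. intros n. induction n as [|n [IH0 IH1]].
  - split; intros z Hz; simpl in *;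
    replace (12 * (1 / 1)) with 12 by field; apply Rabs_rgamma_le_12; lra.
  - split; [assumption|]. intros z Hz.
    simpl Nat.div2. set (m := Nat.div2 n) in *.
    assert (Pn := INR_fact_lt_0 n). assert (Pm := INR_fact_lt_0 m).
    assert (Hm : INR m <= INR n) by
      (apply le_INR; unfold m; rewrite Nat.div2_div; apply Nat.Div0.div_le_upper_bound; lia).
    assert (Qm := pos_INR m).
    replace (INR (Factorial.fact (S (S n))) / INR (Factorial.fact (S m))) with
      ((INR n + 2) * ((INR n + 1) / (INR m + 1) * (INR (Factorial.fact n) / INR (Factorial.fact m)))).
    2: { rewrite !fact_simpl, !mult_INR, !S_INR. field. lra. }
    set (q := INR (Factorial.fact n) / INR (Factorial.fact m)) in *.
    assert (Pq : 0 <= q) by (apply Rmult_le_pos; [|left; apply Rinv_0_lt_compat]; lra).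
    assert (Pr : 1 <= (INR n + 1) / (INR m + 1)).
    { apply Rmult_le_reg_r with (INR m + 1); [lra|]. unfold Rdiv.
      rewrite Rmult_assoc, Rinv_l; lra. }
    rewrite !S_INR in Hz.
    apply Rmult_le_compat_r with (r := q) in Pr; [|assumption].
    set (r := (INR n + 1) / (INR m + 1) * q) in *. clearbody r q.
    assert (K : (INR n + 2) * q <= (INR n + 2) * r) by (apply Rmult_le_compat_l; lra).
    destruct (Rle_lt_dec 0 z) as [L|L].
    + specialize (IH0 z ltac:(lra)).
      assert (0 <= INR n * q) by (apply Rmult_le_pos; lra). lra.
    + rewrite rgamma_succ, Rabs_mult.
      specialize (IH0 (z + 1) ltac:(lra)).
      assert (Rabs z <= INR n + 2) by (rewrite Rabs_left; lra).
      apply Rle_trans with ((INR n + 2) * (12 * q)); [|lra].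
      apply Rmult_le_compat; try apply Rabs_pos; assumption.
Qed.

(** * Dominated convergence of Wright series *)

Lemma Series_tail_le (a B : nat -> R) (N : nat) :
  (forall n, Rabs (a n) <= B n) -> ex_series B ->
  Rabs (Series a - sum_f_R0 a N) <= Series B - sum_f_R0 B N.
Proof.
  intros H EB.
  assert (Ea : ex_series (fun n => Rabs (a n))).
  { apply (ex_series_le (V := R_CompleteNormedModule)) with (2 := EB).
    intros n. change (Rabs (Rabs (a n)) <= B n). now rewrite Rabs_Rabsolu. }
  rewrite (Series_incr_n a (S N)), (Series_incr_n B (S N)); try lia; try assumption;
    [|now apply ex_series_Rabs].
  simpl pred.
  replace (_ + _ - _) with (Series (fun k => a (S N + k)%nat)) by ring.
  replace (_ + _ - _) with (Series (fun k => B (S N + k)%nat)) by ring.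
  apply Rle_trans with (Series (fun k => Rabs (a (S N + k)%nat))).
  - apply Series_Rabs. now apply (ex_series_incr_n (fun n => Rabs (a n)) (S N)).
  - apply Series_le.
    + intros n. split; [apply Rabs_pos|apply H].
    + now apply (ex_series_incr_n B (S N)).
Qed.

(** * Limits along a filter and Tannery's theorem *)

Lemma filterlim_Rplus {T} (F : (T -> Prop) -> Prop) {FF : Filter F} (f g : T -> R) (a b : R) :
  filterlim f F (locally a) -> filterlim g F (locally b) ->
  filterlim (fun t => f t + g t) F (locally (a + b)).
Proof.
  intros Hf Hg. apply (filterlim_comp_2 _ _ _ Hf Hg (filterlim_plus (V := R_NormedModule) a b)).
Qed.

Lemma filterlim_Rmult {T} (F : (T -> Prop) -> Prop) {FF : Filter F} (f g : T -> R) (a b : R) :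
  filterlim f F (locally a) -> filterlim g F (locally b) ->
  filterlim (fun t => f t * g t) F (locally (a * b)).
Proof.
  intros Hf Hg. apply (filterlim_comp_2 _ _ _ Hf Hg (filterlim_mult (K := R_AbsRing) a b)).
Qed.

Lemma filterlim_Rinv {T} (F : (T -> Prop) -> Prop) {FF : Filter F} (f : T -> R) (a : R) :
  a <> 0 -> filterlim f F (locally a) -> filterlim (fun t => / f t) F (locally (/ a)).
Proof.
  intros Ha Hf. apply filterlim_comp with (1 := Hf).
  apply (ex_derive_continuous (V := R_NormedModule) Rinv). auto_derive. assumption.
Qed.

Lemma filterlim_pow {T} (F : (T -> Prop) -> Prop) {FF : Filter F} (f : T -> R) (a : R) (n : nat) :
  filterlim f F (locally a) -> filterlim (fun t => f t ^ n) F (locally (a ^ n)).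
Proof.
  intros Hf. induction n as [|n IH]; simpl.
  - apply filterlim_const.
  - now apply filterlim_Rmult.
Qed.

Lemma filterlim_sum_f_R0 {T} (F : (T -> Prop) -> Prop) {FF : Filter F}
  (u : T -> nat -> R) (v : nat -> R) (N : nat) :
  (forall n, filterlim (fun t => u t n) F (locally (v n))) ->
  filterlim (fun t => sum_f_R0 (u t) N) F (locally (sum_f_R0 v N)).
Proof.
  intros H. induction N as [|N IH]; simpl; [apply H|].
  now apply filterlim_Rplus.
Qed.

Lemma filterlim_Series_dominated {T} (F : (T -> Prop) -> Prop) {FF : Filter F}
  (u : T -> nat -> R) (v B : nat -> R) :
  ex_series B ->
  F (fun t => forall n, Rabs (u t n) <= B n) ->
  (forall n, Rabs (v n) <= B n) ->
  (forall n, filterlim (fun t => u t n) F (locally (v n))) ->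
  filterlim (fun t => Series (u t)) F (locally (Series v)).
Proof.
  intros EB Hu Hv Hlim. apply filterlim_locally. intros eps.
  assert (P3 : 0 < eps / 3) by (generalize (cond_pos eps); lra).
  assert (HN : exists N, Series B - sum_f_R0 B N < eps / 3).
  { generalize (Series_correct B EB). intros HB.
    assert (L : is_lim_seq (sum_n B) (Series B)) by exact HB.
    apply is_lim_seq_spec in L. destruct (L (mkposreal _ P3)) as [N HN].
    exists N. specialize (HN N (Nat.le_refl N)). rewrite sum_n_Reals in HN.
    simpl in HN. apply Rabs_def2 in HN. lra. }
  destruct HN as [N HN].
  assert (HS := filterlim_sum_f_R0 F u v N Hlim).
  assert (HS' := proj1 (filterlim_locally _ _) HS (mkposreal _ P3)).
  generalize (filter_and _ _ Hu HS'). apply filter_imp. intros t [H1 H2].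
  change (Rabs (sum_f_R0 (u t) N - sum_f_R0 v N) < eps / 3) in H2.
  change (Rabs (Series (u t) - Series v) < eps).
  generalize (Series_tail_le _ _ N H1 EB) (Series_tail_le _ _ N Hv EB). intros H3 H4.
  replace (Series (u t) - Series v) with ((Series (u t) - sum_f_R0 (u t) N) +
    ((sum_f_R0 (u t) N - sum_f_R0 v N) + - (Series v - sum_f_R0 v N))) by ring.
  apply Rle_lt_trans with (1 := Rabs_triang _ _).
  generalize (Rabs_triang (sum_f_R0 (u t) N - sum_f_R0 v N) (- (Series v - sum_f_R0 v N))).
  rewrite Rabs_Ropp. lra.
Qed.

(** What remains of the bound on [rgamma] once its [n!] cancels the one in the Wright term. *)
Definition Wright_majorant (r : R) (n : nat) : R :=
  12 / INR (Factorial.fact (Nat.div2 n)) * r ^ n.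

(** Each factorial occurs twice: the even terms form 12 times the exponential series at [r^2], and
    the odd ones the same up to a factor [r]. *)
Lemma ex_series_Wright_majorant (r : R) : ex_series (Wright_majorant r).
Proof.
  assert (E : ex_pseries (fun n => 12 / INR (Factorial.fact n)) (r ^ 2)).
  { apply (ex_pseries_scal (V := R_NormedModule) 12 (fun n => / INR (Factorial.fact n))).
    - apply Rmult_comm.
    - eexists. apply is_exp_Reals. }
  assert (H : ex_pseries (fun n => 12 / INR (Factorial.fact (Nat.div2 n))) r).
  { apply ex_pseries_odd_even.
    - apply ex_series_ext with (2 := E). intros n. now rewrite Nat.div2_double.
    - apply ex_series_ext with (2 := E). intros n.
      now rewrite Nat.add_1_r, Nat.div2_succ_double. }
  apply ex_series_ext with (2 := H). intros n. unfold Wright_majorant.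
  rewrite pow_n_pow. apply Rmult_comm.
Qed.

Lemma Wright_term_le (z a b r : R) (n : nat) :
  - / 2 <= a <= 0 -> 0 <= b <= 1 -> Rabs z <= r ->
  Rabs (z ^ n / INR (Factorial.fact n) * rgamma (INR n * a + b)) <= Wright_majorant r n.
Proof.
  intros Ha Hb Hz. unfold Wright_majorant.
  assert (Pn := INR_fact_lt_0 n). assert (Pm := INR_fact_lt_0 (Nat.div2 n)).
  assert (Qn := pos_INR n).
  assert (H : Rabs (rgamma (INR n * a + b)) <=
    12 * (INR (Factorial.fact n) / INR (Factorial.fact (Nat.div2 n)))).
  { apply Rabs_rgamma_le. split; nra. }
  unfold Rdiv. rewrite 2!Rabs_mult, (Rabs_pos_eq (/ _)) by (left; now apply Rinv_0_lt_compat).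
  rewrite <- RPow_abs.
  replace (12 * / INR (Factorial.fact (Nat.div2 n)) * r ^ n) with
    (r ^ n * / INR (Factorial.fact n)
     * (12 * (INR (Factorial.fact n) / INR (Factorial.fact (Nat.div2 n))))) by (field; lra).
  apply Rmult_le_compat; try apply Rabs_pos; try assumption.
  - apply Rmult_le_pos; [apply pow_le, Rabs_pos|left; now apply Rinv_0_lt_compat].
  - apply Rmult_le_compat_r; [left; now apply Rinv_0_lt_compat|].
    apply pow_incr. split; [apply Rabs_pos|assumption].
Qed.

Lemma filterlim_Wright {T} (F : (T -> Prop) -> Prop) {FF : Filter F}
  (z a b : T -> R) (z0 a0 b0 : R) :
  F (fun t => - / 2 <= a t <= 0 /\ 0 <= b t <= 1) ->
  - / 2 <= a0 <= 0 -> 0 <= b0 <= 1 ->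
  filterlim z F (locally z0) -> filterlim a F (locally a0) -> filterlim b F (locally b0) ->
  filterlim (fun t => Wright (z t) (a t) (b t)) F (locally (Wright z0 a0 b0)).
Proof.
  intros Hab Ha0 Hb0 Hz Ha Hb. unfold Wright.
  (* The margin 1 lets the moving argument [z t] stay eventually under the majorant. *)
  apply filterlim_Series_dominated with (B := Wright_majorant (Rabs z0 + 1)).
  - assumption.
  - apply ex_series_Wright_majorant.
  - assert (Hz' := proj1 (filterlim_locally _ _) Hz (mkposreal _ Rlt_0_1)).
    generalize (filter_and _ _ Hab Hz'). apply filter_imp. intros t [[H1 H2] H3] n.
    apply Wright_term_le; try assumption.
    change (Rabs (z t - z0) < 1) in H3. generalize (Rabs_triang (z t - z0) z0).
    replace (z t - z0 + z0) with (z t) by ring. lra.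
  - intros n. apply Wright_term_le; try assumption. lra.
  - intros n. apply filterlim_Rmult; [assumption| |].
    + apply filterlim_Rmult; [assumption|now apply filterlim_pow|apply filterlim_const].
    + apply filterlim_comp with (f := fun t => INR n * a t + b t) (G := locally (INR n * a0 + b0)).
      * apply filterlim_Rplus; [assumption| |assumption].
        apply filterlim_Rmult; [assumption|apply filterlim_const|assumption].
      * apply continuous_rgamma. generalize (pos_INR n). nra.
Qed.

Lemma Wright_PSeries (z a b : R) :
  Wright z a b = PSeries (fun n => rgamma (INR n * a + b) / INR (Factorial.fact n)) z.
Proof. apply Series_ext. intros n. unfold Rdiv. ring. Qed.

(** Termwise differentiation lowers the index by one, so [(n + 1) a + b] is read as
    [n a + (a + b)]. *)
Lemma is_derive_Wright (z a b : R) : - / 2 <= a <= 0 -> 0 <= b <= 1 ->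
  is_derive (fun z => Wright z a b) z (Wright z a (a + b)).
Proof.
  intros Ha Hb.
  set (c := fun n => rgamma (INR n * a + b) / INR (Factorial.fact n)).
  apply is_derive_ext with (PSeries c).
  { intros t. symmetry. apply Wright_PSeries. }
  replace (Wright z a (a + b)) with (PSeries (PS_derive c) z).
  - apply is_derive_PSeries.
    (* The majorant converges at radius [|z| + 1], which puts [z] strictly inside the disk of
       convergence. *)
    apply Rbar_lt_le_trans with (Rabs z + 1); [simpl; lra|].
    unfold CV_radius. apply (proj1 (Lub_Rbar_correct (CV_disk c))).
    unfold CV_disk. apply (ex_series_le (V := R_CompleteNormedModule))
      with (2 := ex_series_Wright_majorant (Rabs z + 1)).
    intros n. change (Rabs (Rabs (c n * (Rabs z + 1) ^ n)) <= Wright_majorant (Rabs z + 1) n).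
    rewrite Rabs_Rabsolu.
    replace (c n * (Rabs z + 1) ^ n) with
      ((Rabs z + 1) ^ n / INR (Factorial.fact n) * rgamma (INR n * a + b))
      by (unfold c, Rdiv; ring).
    apply Wright_term_le; try assumption.
    rewrite Rabs_pos_eq; [lra|]. generalize (Rabs_pos z); lra.
  - rewrite Wright_PSeries. apply PSeries_ext. intros n. unfold PS_derive, c.
    rewrite fact_simpl, mult_INR.
    replace (INR (S n) * a + b) with (INR n * a + (a + b)) by (rewrite S_INR; ring).
    field. split; [apply INR_fact_neq_0|apply not_0_INR; lia].
Qed.

(** * The Wright function of parameter -1/2 *)

Lemma Wright_0_l (a b : R) : Wright 0 a b = rgamma b.
Proof.
  rewrite Wright_PSeries, PSeries_0. simpl.
  replace (0 * a + b) with b by ring. apply Rdiv_1_r.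
Qed.

(** The constant term is [1/Gamma(0) = 0]; in the others the recurrence yields a factor [(n + 1) a],
    whose [n + 1] cancels in [(n + 1)!]. At [a = - 1/2] this expresses the derivative of
    [Wright z a (1/2)] through the function itself. *)
Lemma Wright_0_r (z a : R) : - / 2 <= a <= 0 -> Wright z a 0 = a * z * Wright z a (a + 1).
Proof.
  intros Ha. unfold Wright. rewrite Series_incr_1.
  - rewrite <- Series_scal_l. simpl (z ^ 0).
    replace (INR 0 * a + 0) with 0 by (simpl; ring).
    rewrite (rgamma_succ 0), Rmult_0_l, Rmult_0_r, Rplus_0_l.
    apply Series_ext. intros n. rewrite rgamma_succ.
    replace (INR (S n) * a + 0 + 1) with (INR n * a + (a + 1)) by (rewrite S_INR; ring).
    rewrite fact_simpl, mult_INR. simpl pow.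
    field. split; [apply INR_fact_neq_0|apply not_0_INR; lia].
  - apply (ex_series_le (V := R_CompleteNormedModule))
      with (2 := ex_series_Wright_majorant (Rabs z)).
    intros n. apply Wright_term_le; lra.
Qed.

(* Both sides solve [y' = - z y / 2]. *)
Lemma Wright_half_half (z : R) : Wright z (- / 2) (/ 2) = exp (- z ^ 2 / 4) / sqrt PI.
Proof.
  assert (D : forall z, is_derive (fun z => exp (z ^ 2 / 4) * Wright z (- / 2) (/ 2)) z 0).
  { intros y.
    replace 0 with (y / 2 * exp (y ^ 2 / 4) * Wright y (- / 2) (/ 2)
                    + exp (y ^ 2 / 4) * Wright y (- / 2) (- / 2 + / 2)).
    - apply (is_derive_mult (fun z => exp (z ^ 2 / 4)) (fun z => Wright z (- / 2) (/ 2))).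
      + auto_derive; trivial. unfold Rdiv. simpl. field.
      + apply is_derive_Wright; lra.
      + intros; apply Rmult_comm.
    - rewrite Rplus_opp_l, Wright_0_r by lra.
      replace (- / 2 + 1) with (/ 2) by field. field. }
  assert (E := constant_of_derive_0 _ D z). simpl in E.
  rewrite Wright_0_l, rgamma_Rinv, Gamma_half in E by lra.
  replace (0 * (0 * 1) / 4) with 0 in E by field. rewrite exp_0, Rmult_1_l in E.
  unfold Rdiv at 1. rewrite <- E.
  replace (- z ^ 2 / 4) with (- (z * (z * 1) / 4)) by (simpl; field).
  rewrite <- Rmult_assoc, <- exp_plus, Rplus_opp_l, exp_0. ring.
Qed.

Lemma one_minus_Wright_half (x : R) : 1 - Wright (- x) (- / 2) 1 = erf (x / 2).
Proof.
  assert (D : forall x, is_derive (fun x => 1 - Wright (- x) (- / 2) 1 - erf (x / 2)) x 0).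
  { intros y.
    assert (D1 : is_derive (fun x => Wright (- x) (- / 2) 1) y (- 1 * Wright (- y) (- / 2) (/ 2))).
    { apply (is_derive_comp (V := R_NormedModule) (fun z => Wright z (- / 2) 1) Ropp).
      - replace (/ 2) with (- / 2 + 1) at 2 by field. apply is_derive_Wright; lra.
      - auto_derive; trivial. }
    assert (D2 : is_derive (fun x => erf (x / 2)) y
              (/ 2 * (2 / sqrt PI * exp (- (y / 2) ^ 2)))).
    { apply (is_derive_comp (V := R_NormedModule) erf (fun x => x / 2)).
      - apply is_derive_scal, is_derive_RInt_gauss.
      - auto_derive; trivial. field. }
    replace 0 with (0 - (- 1 * Wright (- y) (- / 2) (/ 2))
                    - / 2 * (2 / sqrt PI * exp (- (y / 2) ^ 2))).
    - apply (is_derive_minus (V := R_NormedModule) (fun x => 1 - Wright (- x) (- / 2) 1)); [|exact D2].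
      apply (is_derive_minus (V := R_NormedModule) (fun _ => 1)); [|exact D1].
      apply (is_derive_const (V := R_NormedModule)).
    - rewrite Wright_half_half. replace (- (- y) ^ 2 / 4) with (- (y / 2) ^ 2) by field.
      field. apply Rgt_not_eq, sqrt_lt_R0, PI_RGT_0. }
  assert (E := constant_of_derive_0 _ D x). simpl in E.
  unfold erf at 2 in E. replace (0 / 2) with 0 in E by field.
  rewrite Ropp_0, Wright_0_l, rgamma_Rinv, Gamma_1, (RInt_point (V := R_CompleteNormedModule)) in E
    by lra.
  change (zero : R) with 0 in E. rewrite Rinv_1 in E. lra.
Qed.

(** * Positivity and monotonicity of erf *)

Lemma RInt_gauss_pos (x : R) : 0 < x -> 0 < RInt (fun u => exp (- u ^ 2)) 0 x.
Proof.
  intros Hx. apply RInt_gt_0; [assumption| |]; intros.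
  - apply exp_pos.
  - apply continuous_gauss.
Qed.

Lemma erf_pos (x : R) : 0 < x -> 0 < erf x.
Proof.
  intros Hx. unfold erf. apply Rmult_lt_0_compat; [|now apply RInt_gauss_pos].
  apply Rdiv_lt_0_compat; [lra|apply sqrt_lt_R0, PI_RGT_0].
Qed.

Lemma erf_increasing (x y : R) : x < y -> erf x < erf y.
Proof.
  intros H. unfold erf. apply Rmult_lt_compat_l.
  { apply Rdiv_lt_0_compat; [lra|apply sqrt_lt_R0, PI_RGT_0]. }
  rewrite <- (RInt_Chasles (V := R_CompleteNormedModule) (fun u => exp (- u ^ 2)) 0 x y)
    by apply ex_RInt_gauss.
  assert (P : 0 < RInt (fun u => exp (- u ^ 2)) x y).
  { apply RInt_gt_0; [assumption| |]; intros; [apply exp_pos|apply continuous_gauss]. }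
  change (RInt (fun u => exp (- u ^ 2)) 0 x <
    RInt (fun u => exp (- u ^ 2)) 0 x + RInt (fun u => exp (- u ^ 2)) x y). lra.
Qed.

Lemma x_exp_sqr_erf_increasing (x y : R) : 0 < x -> x < y ->
  x * exp (x ^ 2) * erf x < y * exp (y ^ 2) * erf y.
Proof.
  intros Hx Hy. generalize (erf_pos x Hx) (erf_increasing x y Hy). intros P H.
  apply Rmult_gt_0_lt_compat; try assumption.
  - apply Rmult_lt_0_compat; [lra|apply exp_pos].
  - apply Rmult_gt_0_lt_compat; try lra.
    + apply exp_pos.
    + apply exp_increasing. nra.
Qed.

(** * The limit a -> 1 *)

Lemma at_left_1_unit : at_left 1 (fun a => 0 < a < 1).
Proof.
  exists (mkposreal 1 Rlt_0_1). intros a Ha La.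
  change (Rabs (a - 1) < 1) in Ha. apply Rabs_def2 in Ha. lra.
Qed.

Lemma filterlim_half_at_left_1 : filterlim (fun a => a / 2) (at_left 1) (locally (/ 2)).
Proof.
  apply (filterlim_filter_le_1 (F := locally 1)).
  { apply locally_within. }
  replace (/ 2) with (1 / 2) by field.
  apply (ex_derive_continuous (V := R_NormedModule) (fun a => a / 2)). auto_derive. trivial.
Qed.

Lemma filterlim_at_left_1_continuous (f : R -> R) :
  continuous f (/ 2) -> filterlim (fun a => f (a / 2)) (at_left 1) (locally (f (/ 2))).
Proof. intros Hf. exact (filterlim_comp _ _ _ _ _ _ _ _ filterlim_half_at_left_1 Hf). Qed.

Lemma filterlim_Gamma_minus :
  filterlim (fun a => Gamma (1 - a / 2)) (at_left 1) (locally (sqrt PI)).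
Proof.
  rewrite <- Gamma_half. replace (Gamma (/ 2)) with (Gamma (1 - / 2)) by (f_equal; field).
  apply (filterlim_at_left_1_continuous (fun y => Gamma (1 - y))).
  apply (continuous_comp (fun y => 1 - y) Gamma).
  - apply (ex_derive_continuous (V := R_NormedModule) (fun y => 1 - y)). auto_derive. trivial.
  - apply continuous_Gamma. lra.
Qed.

Lemma filterlim_Gamma_plus :
  filterlim (fun a => Gamma (1 + a / 2)) (at_left 1) (locally (sqrt PI / 2)).
Proof.
  replace (sqrt PI / 2) with (Gamma (1 + / 2)).
  2: { rewrite Rplus_comm, Gamma_succ, Gamma_half by lra. field. }
  apply (filterlim_at_left_1_continuous (fun y => Gamma (1 + y))).
  apply (continuous_comp (fun y => 1 + y) Gamma).
  - apply (ex_derive_continuous (V := R_NormedModule) (fun y => 1 + y)). auto_derive. trivial.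
  - apply continuous_Gamma. lra.
Qed.

Lemma filterlim_one_minus_Wright {T} (F : (T -> Prop) -> Prop) {FF : Filter F} (a z : T -> R) (z0 : R) :
  filterlim a F (at_left 1) -> filterlim z F (locally z0) ->
  filterlim (fun t => 1 - Wright (- z t) (- (a t / 2)) 1) F (locally (erf (z0 / 2))).
Proof.
  intros Ha Hz. rewrite <- one_minus_Wright_half.
  apply (filterlim_comp _ _ _ (fun t => Wright (- z t) (- (a t / 2)) 1) (fun w => 1 - w) F
           (locally (Wright (- z0) (- / 2) 1))).
  2: { apply (ex_derive_continuous (V := R_NormedModule) (fun w => 1 - w)). auto_derive. trivial. }
  apply filterlim_Wright; try lra; try assumption.
  - apply (filter_imp (fun t => 0 < a t < 1)); [intros t Ht; lra|exact (Ha _ at_left_1_unit)].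
  - exact (filterlim_comp _ _ _ _ _ _ _ _ Hz (filterlim_opp (V := R_NormedModule) z0)).
  - apply (filterlim_comp _ _ _ (fun t => a t / 2) Ropp F (locally (/ 2))).
    + exact (filterlim_comp _ _ _ _ _ _ _ _ Ha filterlim_half_at_left_1).
    + apply (filterlim_opp (V := R_NormedModule)).
  - apply filterlim_const.
Qed.

Lemma filterlim_Mainardi {T} (F : (T -> Prop) -> Prop) {FF : Filter F} (a z : T -> R) (z0 : R) :
  filterlim a F (at_left 1) -> filterlim z F (locally z0) ->
  filterlim (fun t => Mainardi (a t / 2) (z t)) F (locally (exp (- (z0 / 2) ^ 2) / sqrt PI)).
Proof.
  intros Ha Hz. replace (- (z0 / 2) ^ 2) with (- (- z0) ^ 2 / 4) by field.
  rewrite <- Wright_half_half. unfold Mainardi.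
  assert (H2 := filterlim_comp _ _ _ _ _ _ _ _ Ha filterlim_half_at_left_1).
  apply filterlim_Wright; try lra; try assumption.
  - apply (filter_imp (fun t => 0 < a t < 1)); [intros t Ht; lra|exact (Ha _ at_left_1_unit)].
  - exact (filterlim_comp _ _ _ _ _ _ _ _ Hz (filterlim_opp (V := R_NormedModule) z0)).
  - exact (filterlim_comp _ _ _ _ _ _ _ _ H2 (filterlim_opp (V := R_NormedModule) (/ 2))).
  - apply (filterlim_comp _ _ _ (fun t => a t / 2) (fun y => 1 - y) F (locally (/ 2))); [exact H2|].
    replace (/ 2) with (1 - / 2) at 2 by field.
    apply (ex_derive_continuous (V := R_NormedModule) (fun y => 1 - y)). auto_derive. trivial.
Qed.

(** * The equation for the front *)

Definition front_ratio (a x : R) : R :=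
  x * (1 - Wright (- x) (- (a / 2)) 1) / Mainardi (a / 2) x.

(** With [y = x / 2], the limit is [2 sqrt PI] times the classical left side at [y]: the 2 comes
    from [x = 2 y], and [sqrt PI] from the Mainardi denominator. This is why the root tends to
    [2 mu1]. *)
Lemma filterlim_front_ratio (x : R) :
  filterlim (fun a => front_ratio a x) (at_left 1)
    (locally (2 * sqrt PI * (x / 2 * exp ((x / 2) ^ 2) * erf (x / 2)))).
Proof.
  assert (Ps : 0 < sqrt PI) by apply sqrt_lt_R0, PI_RGT_0.
  assert (Pe := exp_pos (- (x / 2) ^ 2)).
  replace (2 * sqrt PI * (x / 2 * exp ((x / 2) ^ 2) * erf (x / 2)))
    with (x * erf (x / 2) * / (exp (- (x / 2) ^ 2) / sqrt PI)).
  - unfold front_ratio, Rdiv at 1.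
    apply filterlim_Rmult; [typeclasses eauto| |].
    + apply filterlim_Rmult; [typeclasses eauto|apply filterlim_const|].
      apply (filterlim_one_minus_Wright (at_left 1) (fun a => a) (fun _ => x)).
      * apply filterlim_id.
      * apply filterlim_const.
    + apply filterlim_Rinv; [typeclasses eauto| |].
      * apply Rgt_not_eq, Rdiv_lt_0_compat; assumption.
      * apply (filterlim_Mainardi (at_left 1) (fun a => a) (fun _ => x)).
        -- apply filterlim_id.
        -- apply filterlim_const.
  - rewrite exp_Ropp. field. repeat split; apply Rgt_not_eq; assumption || apply exp_pos.
Qed.

Lemma continuous_front_ratio (a x : R) : 0 < a < 1 -> Mainardi (a / 2) x <> 0 ->
  continuous (front_ratio a) x.
Proof.
  intros Ha HM. unfold front_ratio, Rdiv at 1.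
  assert (HO : filterlim Ropp (locally x) (locally (- x)))
    by apply (filterlim_opp (V := R_NormedModule)).
  assert (HW : forall b, 0 <= b <= 1 -> filterlim (fun y => Wright (- y) (- (a / 2)) b) (locally x)
            (locally (Wright (- x) (- (a / 2)) b))).
  { intros b Hb. apply (filterlim_Wright (locally x) Ropp (fun _ => - (a / 2)) (fun _ => b));
      try lra; try assumption; try apply filterlim_const.
    apply filter_forall. intros _. lra. }
  apply (filterlim_Rmult (locally x) (fun y => y * (1 - Wright (- y) (- (a / 2)) 1))
    (fun y => / Mainardi (a / 2) y)).
  - apply (filterlim_Rmult (locally x) (fun y => y)); [apply filterlim_id|].
    apply (filterlim_comp _ _ _ (fun y => Wright (- y) (- (a / 2)) 1) (fun w => 1 - w) (locally x)
           (locally (Wright (- x) (- (a / 2)) 1))).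
    + apply HW. lra.
    + apply (ex_derive_continuous (V := R_NormedModule) (fun w => 1 - w)). auto_derive. trivial.
  - apply (filterlim_Rinv (locally x) (fun y => Mainardi (a / 2) y)); [assumption|].
    apply HW. lra.
Qed.

Lemma filterlim_lt {T} (F : (T -> Prop) -> Prop) {FF : Filter F} (f g : T -> R) (lf lg : R) :
  filterlim f F (locally lf) -> filterlim g F (locally lg) -> lf < lg ->
  F (fun a => f a < g a).
Proof.
  intros Hf Hg H.
  assert (P : 0 < (lg - lf) / 2) by lra.
  generalize (filter_and _ _ (proj1 (filterlim_locally _ _) Hf (mkposreal _ P))
                             (proj1 (filterlim_locally _ _) Hg (mkposreal _ P))).
  apply filter_imp. intros a [H1 H2].
  change (Rabs (f a - lf) < (lg - lf) / 2) in H1. change (Rabs (g a - lg) < (lg - lf) / 2) in H2.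
  apply Rabs_def2 in H1. apply Rabs_def2 in H2. lra.
Qed.

(* The limit equation changes sign at [2 * mu], hence so does the equation at [a] close to [1];
   the intermediate value theorem then traps [xi a]. *)
Lemma filterlim_front_root (xi r : R -> R) (mu : R) :
  0 < mu ->
  (forall a, 0 < a < 1 -> forall x, 0 < x -> front_ratio a x = r a -> x = xi a) ->
  filterlim r (at_left 1) (locally (2 * sqrt PI * (mu * exp (mu ^ 2) * erf mu))) ->
  filterlim xi (at_left 1) (locally (2 * mu)).
Proof.
  intros Hmu Hxi Hr. apply filterlim_locally. intros eps.
  assert (Ps : 0 < sqrt PI) by apply sqrt_lt_R0, PI_RGT_0.
  (* A joint limit in order and argument: it gives one radius [d0] around [2 mu] on which the
     denominator is positive for all [a] close to 1. *)
  assert (HM := filterlim_Mainardi (filter_prod (at_left 1) (locally (2 * mu))) fst snd (2 * mu)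
     filterlim_fst filterlim_snd).
  set (m := exp (- (2 * mu / 2) ^ 2) / sqrt PI) in HM.
  assert (Pm : 0 < m) by (apply Rdiv_lt_0_compat; [apply exp_pos|assumption]).
  assert (HM' := HM _ (open_gt 0 m Pm)). destruct HM' as [Q S HQ [d0 HS] HQS].
  (* The three bounds keep the window inside the ball of radius [d0], within [eps] of [2 mu], and on
     the positive axis, since [2 mu - d >= mu]. *)
  set (d := Rmin (Rmin (d0 / 2) (eps / 2)) mu).
  assert (Pd : 0 < d).
  { generalize (cond_pos d0) (cond_pos eps). intros. unfold d. repeat apply Rmin_glb_lt; lra. }
  assert (L1 : d <= d0 / 2) by (apply Rle_trans with (1 := Rmin_l _ _), Rmin_l).
  assert (L2 : d <= eps / 2) by (apply Rle_trans with (1 := Rmin_l _ _), Rmin_r).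
  assert (L3 : d <= mu) by apply Rmin_r.
  assert (E1 : at_left 1 (fun a => front_ratio a (2 * mu - d) < r a)).
  { apply (filterlim_lt (at_left 1) _ _ _ _ (filterlim_front_ratio _) Hr).
    apply Rmult_lt_compat_l; [lra|]. apply x_exp_sqr_erf_increasing; lra. }
  assert (E2 : at_left 1 (fun a => r a < front_ratio a (2 * mu + d))).
  { apply (filterlim_lt (at_left 1) _ _ _ _ Hr (filterlim_front_ratio _)).
    apply Rmult_lt_compat_l; [lra|]. apply x_exp_sqr_erf_increasing; lra. }
  generalize (filter_and _ _ (filter_and _ _ HQ at_left_1_unit) (filter_and _ _ E1 E2)).
  apply filter_imp. intros a [[Qa Ha] [H1 H2]].
  destruct (Ranalysis5.IVT_interv (fun x => front_ratio a x - r a) (2 * mu - d) (2 * mu + d))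
    as [x [Hx Ex]];
    try lra.
  - intros x Hx. apply continuity_pt_filterlim.
    apply (continuous_minus (V := R_NormedModule) (front_ratio a) (fun _ => r a));
      [|apply continuous_const].
    apply continuous_front_ratio; [assumption|].
    apply Rgt_not_eq. apply (HQS a x Qa). apply HS.
    change (Rabs (x - 2 * mu) < d0). apply Rabs_def1; generalize (cond_pos d0); lra.
  - rewrite <- (Hxi a Ha x) by lra.
    change (Rabs (x - 2 * mu) < eps). apply Rabs_def1; generalize (cond_pos eps); lra.
Qed.

Theorem theorem9 (k c l Tm T0 q0 : R) (xi : R -> R) (mu1 : R) :
  0 < k -> 0 < c -> 0 < l -> Tm < T0 -> 0 < q0 ->
  (* xi_alpha is the unique positive solution of its equation, 0 < alpha < 1 *)
  (forall a, 0 < a < 1 ->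
     0 < xi a /\
     xi a * (1 - Wright (- xi a) (- (a / 2)) 1) / Mainardi (a / 2) (xi a)
       = c * (T0 - Tm) * Gamma (1 - a / 2) / (l * Gamma (1 + a / 2)) /\
     (forall x, 0 < x ->
        x * (1 - Wright (- x) (- (a / 2)) 1) / Mainardi (a / 2) x
          = c * (T0 - Tm) * Gamma (1 - a / 2) / (l * Gamma (1 + a / 2)) ->
        x = xi a)) ->
  (* mu1 is the unique positive solution of its equation *)
  0 < mu1 ->
  mu1 * exp (mu1 ^ 2) * erf mu1 = c * (T0 - Tm) / (l * sqrt PI) ->
  (forall x, 0 < x -> x * exp (x ^ 2) * erf x = c * (T0 - Tm) / (l * sqrt PI) -> x = mu1) ->
  let lam a := k * (T0 - Tm) / (q0 * Gamma (1 - a / 2) * (1 - Wright (- xi a) (- (a / 2)) 1)) in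
  let rho a := q0 ^ 2 * (Gamma (1 - a / 2)) ^ 2 / (k * c * (T0 - Tm) ^ 2)
                 * (1 - Wright (- xi a) (- (a / 2)) 1) ^ 2 in
  let s a t := lam a * xi a * Rpower t (a / 2) in
  let T a x t := T0 - (T0 - Tm) / (1 - Wright (- xi a) (- (a / 2)) 1)
                   * (1 - Wright (- (x / (lam a * Rpower t (a / 2)))) (- (a / 2)) 1) in
  let lam1 := k * (T0 - Tm) / (q0 * sqrt PI * erf mu1) in
  let rho1 := PI * q0 ^ 2 / (k * c * (T0 - Tm) ^ 2) * (erf mu1) ^ 2 in
  let s1 t := 2 * lam1 * mu1 * sqrt t in
  let T1 x t := T0 - (T0 - Tm) / erf mu1 * erf (x / (2 * lam1 * sqrt t)) in
  filterlim rho (at_left 1) (locally rho1) /\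
  (forall t, 0 < t -> filterlim (fun a => s a t) (at_left 1) (locally (s1 t))) /\
  (forall x t, 0 <= x -> 0 < t ->
     filterlim (fun a => T a x t) (at_left 1) (locally (T1 x t))).
Proof.
  intros Hk Hc Hl HT Hq Hxi Hmu1 Heq _ lam rho s T lam1 rho1 s1 T1.
  assert (Ps : 0 < sqrt PI) by apply sqrt_lt_R0, PI_RGT_0.
  assert (Pe := erf_pos mu1 Hmu1).
  assert (HG := filterlim_Gamma_minus).
  assert (Lxi : filterlim xi (at_left 1) (locally (2 * mu1))).
  { apply filterlim_front_root
      with (r := fun a => c * (T0 - Tm) * Gamma (1 - a / 2) / (l * Gamma (1 + a / 2))).
    - assumption.
    - intros a Ha. apply (Hxi a Ha).
    (* The ratio of Gamma values tends to [sqrt PI / (sqrt PI / 2) = 2], so the right side tends to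
       [2 sqrt PI] times the classical one, the same factor as for [front_ratio]. *)
    - rewrite Heq.
      replace (2 * sqrt PI * (c * (T0 - Tm) / (l * sqrt PI)))
        with (c * (T0 - Tm) * sqrt PI * / (l * (sqrt PI / 2))) by (field; lra).
      apply filterlim_Rmult; [typeclasses eauto| |].
      + apply filterlim_Rmult; [typeclasses eauto|apply filterlim_const|exact HG].
      + apply filterlim_Rinv; [typeclasses eauto| |].
        * apply Rgt_not_eq, Rmult_lt_0_compat; lra.
        * apply filterlim_Rmult; [typeclasses eauto|apply filterlim_const|].
          apply filterlim_Gamma_plus. }
  set (D := fun a => 1 - Wright (- xi a) (- (a / 2)) 1).
  assert (LD : filterlim D (at_left 1) (locally (erf mu1))).
  { replace mu1 with (2 * mu1 / 2) by field.
    apply (filterlim_one_minus_Wright (at_left 1) (fun a => a) xi); [apply filterlim_id|exact Lxi]. }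
  assert (Pq : 0 < q0 * sqrt PI * erf mu1)
    by (apply Rmult_lt_0_compat; [apply Rmult_lt_0_compat|]; assumption).
  assert (Plam1 : 0 < lam1).
  { apply Rdiv_lt_0_compat; [apply Rmult_lt_0_compat; lra|exact Pq]. }
  assert (Llam : filterlim lam (at_left 1) (locally lam1)).
  { apply (filterlim_Rmult (at_left 1) (fun _ => k * (T0 - Tm))); [apply filterlim_const|].
    apply (filterlim_Rinv (at_left 1) (fun a => q0 * Gamma (1 - a / 2) * D a)).
    { apply Rgt_not_eq. exact Pq. }
    apply filterlim_Rmult; [typeclasses eauto| |exact LD].
    apply filterlim_Rmult; [typeclasses eauto|apply filterlim_const|exact HG]. }
  assert (Lt : forall t, 0 < t ->
    filterlim (fun a => Rpower t (a / 2)) (at_left 1) (locally (sqrt t))).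
  { intros t Ht. rewrite <- Rpower_sqrt by assumption.
    apply (filterlim_at_left_1_continuous (Rpower t)).
    apply (ex_derive_continuous (V := R_NormedModule) (Rpower t)).
    unfold Rpower. auto_derive. trivial. }
  split; [|split].
  - unfold rho1. replace (PI * q0 ^ 2) with (q0 ^ 2 * sqrt PI ^ 2)
      by (rewrite pow2_sqrt by (left; apply PI_RGT_0); ring).
    apply (filterlim_Rmult (at_left 1) (fun a => q0 ^ 2 * Gamma (1 - a / 2) ^ 2
             / (k * c * (T0 - Tm) ^ 2)) (fun a => D a ^ 2)).
    + apply filterlim_Rmult; [typeclasses eauto| |apply filterlim_const].
      apply filterlim_Rmult; [typeclasses eauto|apply filterlim_const|].
      apply filterlim_pow; [typeclasses eauto|exact HG].
    + apply filterlim_pow; [typeclasses eauto|exact LD].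
  - intros t Ht. unfold s1. replace (2 * lam1 * mu1) with (lam1 * (2 * mu1)) by ring.
    apply filterlim_Rmult; [typeclasses eauto| |exact (Lt t Ht)].
    apply filterlim_Rmult; [typeclasses eauto|exact Llam|exact Lxi].
  - intros x t Hx Ht. assert (Pt := sqrt_lt_R0 t Ht).
    (* The half is split off because [filterlim_one_minus_Wright] yields [erf] at half the limit of
       the Wright argument. *)
    unfold T1. replace (x / (2 * lam1 * sqrt t)) with (x / (lam1 * sqrt t) / 2) by (field; lra).
    apply (filterlim_comp _ _ _
      (fun a => (T0 - Tm) / D a * (1 - Wright (- (x / (lam a * Rpower t (a / 2)))) (- (a / 2)) 1))
      (fun y => T0 - y) _
      (locally ((T0 - Tm) / erf mu1 * erf (x / (lam1 * sqrt t) / 2)))).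
    2: { apply (ex_derive_continuous (V := R_NormedModule) (fun y => T0 - y)). auto_derive. trivial. }
    apply filterlim_Rmult; [typeclasses eauto| |].
    + apply filterlim_Rmult; [typeclasses eauto|apply filterlim_const|].
      apply filterlim_Rinv; [typeclasses eauto|lra|exact LD].
    + apply (filterlim_one_minus_Wright (at_left 1) (fun a => a)
        (fun a => x / (lam a * Rpower t (a / 2)))); [apply filterlim_id|].
      apply filterlim_Rmult; [typeclasses eauto|apply filterlim_const|].
      apply filterlim_Rinv; [typeclasses eauto| |].
      * apply Rgt_not_eq. now apply Rmult_lt_0_compat.
      * apply filterlim_Rmult; [typeclasses eauto|exact Llam|exact (Lt t Ht)].
Qed.
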